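(* Let $F=F(X)$ be a free group of finite rank at least $2$ with free basis $X$. For every recursively enumerable normal subgroup $N\unlhd F$ the following hold. (a) $\mathrm{PP}(F/N')$ is decidable if and only if $\mathrm{PP}(F/N'')$ is decidable. (b) $\mathrm{CP}(F/N'')$ is decidable if and only if $\mathrm{CP}(F/N''')$ is decidable. (c) $\mathrm{WP}(F/N'')$ is decidable if and only if $\mathrm{PP}(F/N'')$ is decidable, if and only if $\mathrm{CP}(F/N'')$ is decidable.
   Context: $N'=[N,N]$, $N''=(N')'$, $N'''=(N'')'$ are the successive derived subgroups of $N$. All quotient groups are considered with the generating set $X$; inputs are words over $X\cup X^{-1}$. $\mathrm{WP}(G)$: given a word $w$ in the generators of $G$, decide whether $w=1$ in $G$. $\mathrm{PP}(G)$: given words $u,v$, decide whether $v=u^k$ in $G$ for some $k\in\mathbb Z$. $\mathrm{CP}(G)$: given words $u,v$, decide whether $u$ and $v$ are conjugate in $G$. *)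

(* Defs.v *)
From HB Require Import structures.
From mathcomp Require Import all_boot ssralg ssrint.
From mathcomp Require Import boolp classical_sets.

Set Implicit Arguments.
Unset Strict Implicit.
Unset Printing Implicit Defensive.

Local Open Scope classical_set_scope.
Local Open Scope group_scope.

(** * Total recursive functions

   The class of general recursive functions as the least class of total
   functions closed under composition, primitive recursion and minimization of
   regular functions.  By Kleene's normal form theorem these are the total
   functions computed by partial recursive schemes (or Turing machines). *)

Inductive recursive : forall k, (k.-tuple nat -> nat) -> Prop :=
| rec_zero k : recursive (fun _ : k.-tuple nat => 0%N)
| rec_succ : recursive (fun v : 1.-tuple nat => (thead v).+1)
| rec_proj k (i : 'I_k) : recursive (fun v : k.-tuple nat => tnth v i)
| rec_comp k m (f : m.-tuple nat -> nat) (g : 'I_m -> k.-tuple nat -> nat) :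
    recursive f -> (forall i, recursive (g i)) ->
    recursive (fun v : k.-tuple nat => f [tuple g i v | i < m])
| rec_prim k (f : k.-tuple nat -> nat) (g : k.+2.-tuple nat -> nat)
    (h : k.+1.-tuple nat -> nat) :
    recursive f -> recursive g ->
    (forall v : k.-tuple nat, h [tuple of 0%N :: v] = f v) ->
    (forall m (v : k.-tuple nat),
       h [tuple of m.+1 :: v] =
       g [tuple of m :: h [tuple of m :: v] :: v]) ->
    recursive h
| rec_min k (f : k.+1.-tuple nat -> nat) (h : k.-tuple nat -> nat) :
    recursive f ->
    (forall v : k.-tuple nat,
       f [tuple of h v :: v] = 0%N /\
       forall m, (m < h v)%N -> f [tuple of m :: v] <> 0%N) ->
    recursive h.

(** * Words over X and its formal inverses *)

(* (i, false) is the letter x_i and (i, true) the letter x_i^-1. *)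
Definition word (n : nat) := seq ('I_n * bool).

Definition letter_value n (G : groupType) (x : 'I_n -> G)
    (a : 'I_n * bool) : G :=
  if a.2 then (x a.1)^-1 else x a.1.

Definition word_value n (G : groupType) (x : 'I_n -> G) (w : word n) : G :=
  foldr (fun a g => letter_value x a * g) 1 w.

Definition letter_code n (a : 'I_n * bool) : nat := (a.1.*2 + a.2)%N.

(* Bijective numeration in base 2n, least significant letter first. *)
Definition word_code n (w : word n) : nat :=
  foldr (fun a c => (c * n.*2 + (letter_code a).+1)%N) 0%N w.

Definition decidable_word_set n (P : word n -> Prop) : Prop :=
  exists f : 1.-tuple nat -> nat,
    recursive f /\ forall w, P w <-> f [tuple word_code w] = 1%N.

Definition decidable_word_rel n (R : word n -> word n -> Prop) : Prop :=
  exists f : 2.-tuple nat -> nat,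
    recursive f /\
    forall u v, R u v <-> f [tuple word_code u; word_code v] = 1%N.

Definition enumerable_word_set n (P : word n -> Prop) : Prop :=
  (forall w, ~ P w) \/
  exists f : 1.-tuple nat -> nat,
    recursive f /\
    forall c, (exists m, f [tuple m] = c) <->
              (exists2 w, P w & word_code w = c).

(** * Groups *)

Definition zexpg (G : groupType) (g : G) (k : int) : G :=
  match k with
  | Posz m => g ^+ m
  | Negz m => g ^- m.+1
  end.

(* The universal property of a free group with free basis x_0, ..., x_(n-1). *)
Definition free_basis n (F : groupType) (x : 'I_n -> F) : Prop :=
  forall (H : groupType) (y : 'I_n -> H),
    (exists f : {multiplicative F -> H}, forall i, f (x i) = y i) /\
    (forall f g : {multiplicative F -> H},
       (forall i, f (x i) = y i) -> (forall i, g (x i) = y i) -> f =1 g).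

Definition is_subgroup (G : groupType) (H : set G) : Prop :=
  [/\ H 1, forall g h, H g -> H h -> H (g * h) & forall g, H g -> H g^-1].

Record normal_subgroup (G : groupType) := NormalSubgroup {
  nsub_set :> set G;
  nsub_subgroup : is_subgroup nsub_set;
  nsub_conj : forall g h : G, nsub_set g -> nsub_set (g ^ h)
}.

Definition commutator_set (G : groupType) (A B : set G) : set G :=
  smallest (@is_subgroup G) [set [~ g, h] | g in A & h in B].

Section Derived.
Variables (G : groupType) (N : normal_subgroup G).

Lemma smallest_subgroup (A : set G) :
  is_subgroup (smallest (@is_subgroup G) A).
Proof.
split=> [H [[]]//|g h gA hA H [sH AH]|g gA H [sH AH]].
  by case: (sH) => _ HM _; apply: HM; [apply: gA|apply: hA].
by case: (sH) => _ _ HV; apply: HV; apply: gA.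
Qed.

Lemma commutator_set_conj (g h : G) :
  commutator_set N N g -> commutator_set N N (g ^ h).
Proof.
have [C1 CM CV] := smallest_subgroup [set [~ a, b] | a in N & b in N].
apply: (_ : commutator_set N N `<=` [set a | commutator_set N N (a ^ h)]).
apply: smallest_sub.
  split=> [|a b|a] /=; first by rewrite conj1g.
    by rewrite conjMg; apply: CM.
  by rewrite conjVg; apply: CV.
move=> _ [a Na [b Nb <-]] /=; rewrite conjRg.
by apply: sub_gen_smallest; exists (a ^ h); [|exists (b ^ h)];
  rewrite //=; apply: nsub_conj.
Qed.

Definition derived : normal_subgroup G :=
  @NormalSubgroup G (commutator_set N N)
    (smallest_subgroup _) commutator_set_conj.

End Derived.

(** * Quotient groups *)

Section Quotient.
Variables (G : groupType) (N : normal_subgroup G).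
Local Open Scope quotient_scope.

Definition coset_rel (g h : G) : bool := `[< nsub_set N (g^-1 * h) >].

Lemma coset_rel_refl : reflexive coset_rel.
Proof. by move=> g; apply/asboolP; rewrite mulVg; case: (nsub_subgroup N). Qed.

Lemma coset_rel_sym : symmetric coset_rel.
Proof.
have [_ _ NV] := nsub_subgroup N.
by move=> g h; apply/asboolP/asboolP => /NV; rewrite invgM invgK.
Qed.

Lemma coset_rel_trans : transitive coset_rel.
Proof.
have [_ NM _] := nsub_subgroup N.
move=> h g k /asboolP gh /asboolP hk; apply/asboolP.
by have := NM _ _ gh hk; rewrite -mulgA mulVKg.
Qed.

Canonical coset_equiv :=
  EquivRel coset_rel coset_rel_refl coset_rel_sym coset_rel_trans.

Definition quotient := {eq_quot coset_equiv}.
HB.instance Definition _ := Choice.on quotient.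

Definition quotient_proj (g : G) : quotient := \pi_{eq_quot coset_equiv} g.

Lemma quotient_projP (g h : G) :
  quotient_proj g = quotient_proj h <-> nsub_set N (g^-1 * h).
Proof. by split=> [/eqmodP/asboolP|gh]; last by apply/eqmodP/asboolP. Qed.

Definition quotient_mul (a b : quotient) : quotient :=
  quotient_proj (repr a * repr b).
Definition quotient_inv (a : quotient) : quotient := quotient_proj (repr a)^-1.

Lemma quotient_reprK (a : quotient) : quotient_proj (repr a) = a.
Proof. exact: reprK. Qed.

Lemma quotient_projM (g h : G) :
  quotient_proj (g * h) = quotient_mul (quotient_proj g) (quotient_proj h).
Proof.
have [_ NM _] := nsub_subgroup N.
rewrite /quotient_mul; set g' := repr _; set h' := repr _.
have /quotient_projP Ng : quotient_proj g = quotient_proj g'.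
  by rewrite quotient_reprK.
have /quotient_projP Nh : quotient_proj h = quotient_proj h'.
  by rewrite quotient_reprK.
apply/quotient_projP.
have := NM _ _ (nsub_conj h Ng) Nh; rewrite /conjg invgM !mulgA.
by rewrite mulgK.
Qed.

Lemma quotient_projV (g : G) :
  quotient_proj g^-1 = quotient_inv (quotient_proj g).
Proof.
have [_ _ NV] := nsub_subgroup N.
rewrite /quotient_inv; set g' := repr _.
have /quotient_projP Ng : quotient_proj g = quotient_proj g'.
  by rewrite quotient_reprK.
apply/quotient_projP; rewrite invgK.
have := NV _ (nsub_conj g^-1 Ng).
by rewrite /conjg !invgM !invgK -!mulgA mulgV mulg1.
Qed.

Lemma quotient_mulA : associative quotient_mul.
Proof.
move=> a b c; rewrite -(quotient_reprK a) -(quotient_reprK b).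
by rewrite -(quotient_reprK c) -!quotient_projM mulgA.
Qed.

Lemma quotient_mul1 : left_id (quotient_proj 1) quotient_mul.
Proof. by move=> a; rewrite -(quotient_reprK a) -quotient_projM mul1g. Qed.

Lemma quotient_mulr1 : right_id (quotient_proj 1) quotient_mul.
Proof. by move=> a; rewrite -(quotient_reprK a) -quotient_projM mulg1. Qed.

Lemma quotient_mulV : left_inverse (quotient_proj 1) quotient_inv quotient_mul.
Proof.
move=> a; rewrite -(quotient_reprK a) -quotient_projV -quotient_projM.
by rewrite mulVg.
Qed.

Lemma quotient_mulrV : right_inverse (quotient_proj 1) quotient_inv quotient_mul.
Proof.
move=> a; rewrite -(quotient_reprK a) -quotient_projV -quotient_projM.
by rewrite mulgV.
Qed.

HB.instance Definition _ := isGroup.Build quotient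
  quotient_mulA quotient_mul1 quotient_mulr1 quotient_mulV quotient_mulrV.

HB.instance Definition _ :=
  isMultiplicative.Build G quotient quotient_proj quotient_projM.

End Quotient.

(** * Algorithmic problems *)

Section Problems.
Variables (n : nat) (G : groupType) (x : 'I_n -> G).

Definition WP (w : word n) : Prop := word_value x w = 1.

Definition PP (u v : word n) : Prop :=
  exists k : int, word_value x v = zexpg (word_value x u) k.

Definition CP (u v : word n) : Prop :=
  exists g : G, word_value x v = word_value x u ^ g.

End Problems.

Section QuotientProblems.
Variables (n : nat) (F : groupType) (x : 'I_n -> F).

Definition enumerable_subset (A : set F) : Prop :=
  enumerable_word_set (fun w => A (word_value x w)).

(* The quotient by M is generated by the images of the generators x_i. *)
Definition quotient_gen (M : normal_subgroup F) (i : 'I_n) : quotient M :=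
  quotient_proj M (x i).

Definition WP_decidable (M : normal_subgroup F) : Prop :=
  decidable_word_set (WP (quotient_gen M)).
Definition PP_decidable (M : normal_subgroup F) : Prop :=
  decidable_word_rel (PP (quotient_gen M)).
Definition CP_decidable (M : normal_subgroup F) : Prop :=
  decidable_word_rel (CP (quotient_gen M)).

End QuotientProblems.

(* Main.v *)
(* Fix a normal subgroup M of F. For a subgroup H of F, the flow of a word in
   the Schreier graph of H (how often each edge is traversed, counted with
   sign) identifies H/[H, H] with the first homology of the graph. All four
   reductions behind the theorem come from this.
   - WP(F/M) decides WP(F/M'): compute the flow in the Cayley graph of F/M.
   - Let u be outside M'. Taking H = <u>M, the element u is not in [H, H]: it
     would lie in M, so that H = M. Hence some edge e has flow_e(u) <> 0, and
     v = u^k modulo M' gives |k| <= |k flow_e(u)| = |flow_e(v)| <= |v|. So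
     PP(F/M') reduces to WP(F/M') by a bounded search, and F/M' is torsion free.
   - Let M = K' and let g be in M but not in M'. If w commutes with g modulo M',
     the finitely supported nonzero flow of g is invariant under translation by
     w, so w has finite order modulo M and lies in M. Hence w is in M iff [w, g]
     is in M', and WP(F/M') decides WP(F/M).
   - Let M = K' and let u, v be conjugate modulo M'. Comparing flows shows that
     the support and the values of the flow of a suitable conjugator are bounded
     in terms of |u| + |v|, so that there is a conjugator of bounded length and
     CP(F/M') reduces to WP(F/M') by a bounded search. *)
From HB Require Import structures.
Require Import Defs.
From mathcomp Require Import all_boot ssralg ssrnum ssrint.
From mathcomp Require Import zify.
From mathcomp Require Import boolp classical_sets.

Set Implicit Arguments.
Unset Strict Implicit.
Unset Printing Implicit Defensive.

Import GRing.Theory.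

(** * Computable functions of an environment *)

(* Environments [nat -> nat] play the role of contexts of variables: [e i] is
   the i-th variable, and a binder of two variables is interpreted by
   [shift2]. *)
Definition shift2 (e : nat -> nat) : nat -> nat := fun i => e i.+2.

(** The arity is existential, so the closure properties below compose functions without tracking how
    many variables each of them reads. *)
Definition computable (f : (nat -> nat) -> nat) : Prop :=
  exists k (g : k.-tuple nat -> nat),
    recursive g /\ forall e, f e = g [tuple e i | i < k].

Fixpoint prim_rec (s : nat -> nat -> nat) (z n : nat) : nat :=
  if n is m.+1 then s m (prim_rec s z m) else z.

Lemma computable_ext f g : f =1 g -> computable f -> computable g.
Proof.
by move=> fg [k [h [hr hE]]]; exists k, h; split=> // e; rewrite -fg.
Qed.

(** Projections pad a recursive function with extra arguments. Several computable functions can thus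
    be brought to a common arity. *)
Lemma computable_arity f : computable f ->
  exists k0, forall k, k0 <= k -> exists2 g : k.-tuple nat -> nat,
    recursive g & forall e, f e = g [tuple e i | i < k].
Proof.
move=> [k0 [g [gr gE]]]; exists k0 => k le_k.
exists (fun v : k.-tuple nat => g [tuple tnth v (widen_ord le_k i) | i < k0]).
  by apply: rec_comp => // i; apply: rec_proj.
by move=> e; rewrite gE; congr g; apply: eq_from_tnth => i;
  rewrite !tnth_mktuple.
Qed.

Lemma computable_comp m (h : m.-tuple nat -> nat)
    (a : 'I_m -> (nat -> nat) -> nat) :
  recursive h -> (forall i, computable (a i)) ->
  computable (fun e => h [tuple a i e | i < m]).
Proof.
move=> hr ar.
have /choice[K KP] : forall i, exists k0, forall k, k0 <= k ->
    exists2 g : k.-tuple nat -> nat,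
    recursive g & forall e, a i e = g [tuple e i | i < k].
  by move=> i; apply: computable_arity.
pose k := \max_i K i.
have /choice[g gP] : forall i, exists g : k.-tuple nat -> nat,
    recursive g /\ forall e, a i e = g [tuple e i | i < k].
  by move=> i; have [|g gr gE] := KP i k; [apply: leq_bigmax|exists g].
exists k, (fun v => h [tuple g i v | i < m]); split.
  by apply: rec_comp => // i; case: (gP i).
move=> e; congr h; apply: eq_from_tnth => i; rewrite !tnth_mktuple.
by case: (gP i).
Qed.

Lemma computable_var i : computable (fun e => e i).
Proof.
exists i.+1, (fun v => tnth v ord_max); split; first exact: rec_proj.
by move=> e; rewrite tnth_mktuple.
Qed.

Lemma computable_rec1 (h : 1.-tuple nat -> nat) a :
  recursive h -> computable a -> computable (fun e => h [tuple a e]).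
Proof.
move=> hr ar; apply: computable_ext (computable_comp (a := fun=> a) hr _) => //.
by move=> e; congr h; apply: eq_from_tnth => i; rewrite tnth_mktuple !ord1.
Qed.

Lemma computable_succ a : computable a -> computable (fun e => (a e).+1).
Proof. exact: (computable_rec1 (h := fun v => (thead v).+1) rec_succ). Qed.

Lemma computable_const c : computable (fun=> c).
Proof.
elim: c => [|c IHc]; last exact: computable_succ.
by exists 0, (fun=> 0); split => //; apply: rec_zero.
Qed.

Lemma computable_shift f : computable f -> computable (fun e => f (shift2 e)).
Proof.
move=> [k [g [gr gE]]].
apply: (computable_ext (f := fun e => g [tuple e (val i).+2 | i < k])) => [e|].
  by rewrite gE.
apply: (computable_comp (a := fun (i : 'I_k) e => e (val i).+2)) => // i.
exact: computable_var.
Qed.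

(** In the body of the recursion, variable 0 is the index, variable 1 the previous value, and
    [shift2] recovers the parameters. *)
Lemma computable_prim_rec s z n :
  computable z -> computable n ->
  computable (fun e => s (shift2 e) (e 0) (e 1)) ->
  computable (fun e => prim_rec (s e) (z e) (n e)).
Proof.
move=> /computable_arity[kz zP] nr /computable_arity[ks sP].
pose k := maxn kz ks.
have [|gz gzr gzE] := zP k; first exact: leq_maxl.
have [|gs gsr gsE] := sP k.+2; first by rewrite !leqW // leq_maxr.
pose push (m r : nat) (e : nat -> nat) i :=
  if i is j.+1 then if j is l.+1 then e l else r else m.
pose env (v : k.-tuple nat) i := nth 0 v i.
have envK v : [tuple env v i | i < k] = v.
  by apply: eq_from_tnth => i; rewrite tnth_mktuple (tnth_nth 0).
pose h (v : k.+1.-tuple nat) :=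
  prim_rec (s (env (tuple.behead_tuple v))) (z (env (tuple.behead_tuple v)))
    (thead v).
have hr : recursive h.
  apply: (rec_prim gzr gsr) => [v|m v].
    by rewrite /h /= gzE; congr gz; apply: etrans (envK _) _; apply: val_inj.
  rewrite /h /=.
  have -> : tuple.behead_tuple [tuple of m.+1 :: v] = v by apply: val_inj.
  have -> : tuple.behead_tuple [tuple of m :: v] = v by apply: val_inj.
  set r := prim_rec _ _ _.
  apply: etrans (gsE (push m r (env v))) _.
  congr gs; apply: eq_from_tnth => i; rewrite tnth_mktuple (tnth_nth 0).
  by case: i => -[|[|i]].
pose a (i : 'I_k.+1) e := if val i is j.+1 then e j else n e : nat.
have ar i : computable (a i).
  by case: i => -[|i] lti //; rewrite /a /=; apply: computable_var.
apply: computable_ext (computable_comp hr ar) => e; rewrite /h.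
set w := mktuple _; have -> : thead w = n e by rewrite /thead tnth_mktuple.
have wE : tuple.behead_tuple w = [tuple e i | i < k].
  apply: eq_from_tnth => i; rewrite tnth_mktuple.
  transitivity (tnth w (lift ord0 i)); last by rewrite tnth_mktuple.
  by rewrite !(tnth_nth 0) nth_behead.
have zE : z (env (tuple.behead_tuple w)) = z e by rewrite !gzE envK wE.
rewrite zE; elim: (n e) => //= m ->.
move: (prim_rec _ _ _) => r.
apply: etrans (gsE (push m r (env (tuple.behead_tuple w)))) _.
apply: etrans _ (esym (gsE (push m r e))).
congr gs; apply: eq_from_tnth => -[[|[|i]] lti]; rewrite !tnth_mktuple //=.
rewrite /env wE -(tnth_nth 0 _ (Ordinal (lti : i < k))).
by rewrite tnth_mktuple.
Qed.

(** Variables beyond the arity read the default 0 of [nth], hence become the constant zero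
    function. *)
Lemma computable_recursive k f :
  computable f -> recursive (fun v : k.-tuple nat => f (nth 0 v)).
Proof.
move=> [m [g [gr gE]]].
have -> : (fun v : k.-tuple nat => f (nth 0 v)) =
    fun v => g [tuple nth 0 v i | i < m] by apply/funext => v; rewrite gE.
apply: rec_comp => // i; case: (ltnP i k) => [lti|lei].
  have -> : (fun v : k.-tuple nat => nth 0 v i) = fun v => tnth v (Ordinal lti).
    by apply/funext => v; rewrite (tnth_nth 0).
  exact: rec_proj.
have -> : (fun v : k.-tuple nat => nth 0 v i) = fun=> 0.
  by apply/funext => v; rewrite nth_default ?size_tuple.
exact: rec_zero.
Qed.

(** * Arithmetic, Boolean operations and bounded quantifiers *)

Lemma computable_add a b : computable a -> computable b ->
  computable (fun e => a e + b e).
Proof.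
move=> ar br.
apply: computable_ext (computable_prim_rec (s := fun _ _ r => r.+1) ar br _).
  by move=> e; elim: (b e) => [|m /= ->]; rewrite ?addn0 ?addnS.
exact/computable_succ/computable_var.
Qed.

Lemma computable_pred a : computable a -> computable (fun e => (a e).-1).
Proof.
move=> ar.
apply: computable_ext (computable_prim_rec (s := fun _ m _ => m)
  (computable_const 0) ar _) => [e|]; first by case: (a e).
exact: computable_var.
Qed.

Lemma computable_sub a b : computable a -> computable b ->
  computable (fun e => a e - b e).
Proof.
move=> ar br.
apply: computable_ext (computable_prim_rec (s := fun _ _ r => r.-1) ar br _).
  by move=> e; elim: (b e) => [|m /= ->]; rewrite ?subn0 ?subnS.
exact/computable_pred/computable_var.
Qed.

Lemma computable_mul a b : computable a -> computable b ->
  computable (fun e => a e * b e).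
Proof.
move=> ar br.
apply: computable_ext (computable_prim_rec (s := fun e _ r => a e + r)
  (computable_const 0) br _).
  by move=> e; elim: (b e) => [|m /= ->]; rewrite ?muln0 ?mulnS.
apply: computable_add; [exact: computable_shift|exact: computable_var].
Qed.

Lemma computable_sum a (F : (nat -> nat) -> nat -> nat) :
  computable a -> computable (fun e => F (shift2 e) (e 0)) ->
  computable (fun e => \sum_(i < a e) F e i).
Proof.
move=> ar Fr; apply: computable_ext (computable_prim_rec
  (s := fun e m r => r + F e m) (computable_const 0) ar _).
  by move=> e; elim: (a e) => [|m /= ->]; rewrite ?big_ord0 ?big_ord_recr.
by apply: computable_add => //; apply: computable_var.
Qed.

Lemma computable_expn a b : computable a -> computable b ->
  computable (fun e => a e ^ b e).
Proof.
move=> ar br; apply: computable_ext (computable_prim_rec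
  (s := fun e _ r => a e * r) (computable_const 1) br _).
  by move=> e; elim: (b e) => [|m /= ->]; rewrite ?expnS.
apply: computable_mul; [exact: computable_shift|exact: computable_var].
Qed.

Lemma computable_leq a b : computable a -> computable b ->
  computable (fun e => a e <= b e : nat).
Proof.
move=> ar br; apply: computable_ext (computable_sub (computable_const 1)
  (computable_sub ar br)) => e.
by rewrite /leq; case: (a e - b e).
Qed.

Lemma computable_not (a : (nat -> nat) -> bool) :
  computable a -> computable (fun e => ~~ a e).
Proof.
move=> ar; apply: computable_ext (computable_sub (computable_const 1) ar) => e.
by case: (a e).
Qed.

Lemma computable_and (a b : (nat -> nat) -> bool) :
  computable a -> computable b -> computable (fun e => a e && b e).
Proof.
by move=> ar br; apply: computable_ext (computable_mul ar br) => e;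
  rewrite mulnb.
Qed.

Lemma computable_or (a b : (nat -> nat) -> bool) :
  computable a -> computable b -> computable (fun e => a e || b e).
Proof.
move=> ar br; apply: computable_ext (computable_not
  (computable_and (computable_not ar) (computable_not br))) => e.
by rewrite negb_and !negbK.
Qed.

Lemma computable_eq a b : computable a -> computable b ->
  computable (fun e => a e == b e : nat).
Proof.
move=> ar br; apply: computable_ext (computable_and (computable_leq ar br)
  (computable_leq br ar)) => e; by rewrite -eqn_leq.
Qed.

Lemma computable_exists a (P : (nat -> nat) -> nat -> bool) :
  computable a -> computable (fun e => P (shift2 e) (e 0)) ->
  computable (fun e => [exists i : 'I_(a e), P e i]).
Proof.
move=> ar Pr; apply: computable_ext (computable_leq (computable_const 1)
  (computable_sum (F := fun e m => P e m) ar Pr)) => e.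
rewrite lt0n sum_nat_eq0; congr (nat_of_bool _).
by rewrite negb_forall; apply: eq_existsb => i; rewrite /= eqb0 negbK.
Qed.

Lemma computable_forall a (P : (nat -> nat) -> nat -> bool) :
  computable a -> computable (fun e => P (shift2 e) (e 0)) ->
  computable (fun e => [forall i : 'I_(a e), P e i]).
Proof.
move=> ar Pr; apply: computable_ext (computable_not (computable_exists
  (P := fun e m => ~~ P e m) ar (computable_not Pr))) => e.
by rewrite negb_exists; congr (nat_of_bool _); apply: eq_forallb => i;
  rewrite negbK.
Qed.

(** This turns bounded counting into a way to compute a number from its comparisons; quotients and
    lengths of words are obtained so. *)
Lemma sum_ltn m k : k <= m -> \sum_(i < m) (i < k : nat) = k.
Proof.
move=> le_k; rewrite -(big_mkord xpredT (fun i => i < k : nat)).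
rewrite (big_cat_nat (leq0n _) le_k) /= [X in _ + X]big_nat_cond.
rewrite [X in _ + X]big1 ?addn0 => [|i]; last first.
  by rewrite andbT => /andP[/leq_gtF->].
rewrite big_nat_cond (eq_bigr (fun=> 1)); last first.
  by move=> i; rewrite andbT => /andP[_ ->].
by rewrite -big_nat_cond sum_nat_const_nat subn0 muln1.
Qed.

Lemma computable_div a d : 0 < d -> computable a ->
  computable (fun e => a e %/ d).
Proof.
move=> d0 ar; have c := computable_const.
apply: computable_ext (computable_sum (F := fun e m => m.+1 * d <= a e) ar _).
  move=> e; under eq_bigr do rewrite -leq_divRL //.
  by rewrite sum_ltn // leq_div.
apply: computable_leq; last exact: computable_shift.
by apply: computable_mul => //; apply/computable_succ/computable_var.
Qed.

Lemma computable_mod a d : 0 < d -> computable a ->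
  computable (fun e => a e %% d).
Proof.
move=> d0 ar; apply: computable_ext (computable_sub ar
  (computable_mul (computable_div d0 ar) (computable_const d))) => e.
by rewrite {1}(divn_eq (a e) d) addKn.
Qed.

(** * Computing with words *)

Definition word_inv n (w : word n) : word n :=
  rev [seq (a.1, ~~ a.2) | a <- w].

Definition word_pow n (w : word n) k : word n := flatten (nseq k w).

Section WordCodes.
Variable n : nat.
Implicit Types (u v w : word n) (a : 'I_n * bool).

Lemma letter_code_lt a : letter_code a < n.*2.
Proof. by case: a => i b; rewrite /letter_code /=; have := ltn_ord i; lia. Qed.

Lemma letter_code_inj : injective (@letter_code n).
Proof.
move=> [i b] [j c] /= eq_ij; congr (_, _); last by move: eq_ij;
  rewrite /letter_code /=; lia.
by apply: val_inj; move: eq_ij; rewrite /letter_code /=; lia.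
Qed.

(** Codes [2i] and [2i+1] are exchanged: the successor of an even code, the predecessor of an odd
    one. *)
Lemma letter_code_inv a :
  letter_code (a.1, ~~ a.2) = (letter_code a).+1 - (letter_code a %% 2).*2.
Proof. by case: a => i b; rewrite /letter_code /= modn2 oddD odd_double /=; lia.
Qed.

Lemma word_code_cons a w :
  word_code (a :: w) = word_code w * n.*2 + (letter_code a).+1.
Proof. by []. Qed.

Lemma word_code_behead w : word_code (behead w) = (word_code w).-1 %/ n.*2.
Proof.
case: w => [|a w]; first by rewrite /= div0n.
have lt_a := letter_code_lt a.
by rewrite word_code_cons addnS /= divnMDl ?divn_small ?addn0 //; lia.
Qed.

Lemma word_code_head a w : (word_code (a :: w)).-1 %% n.*2 = letter_code a.
Proof. by rewrite word_code_cons addnS /= modnMDl modn_small ?letter_code_lt.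
Qed.

Lemma word_code_inj : injective (@word_code n).
Proof.
elim=> [|a u IHu] [|b v] //; try by rewrite word_code_cons addnS.
move=> eq_uv.
have eq_ab : a = b.
  by apply: letter_code_inj; rewrite -(word_code_head a u) -(word_code_head b v)
    eq_uv.
congr (_ :: _) => //; apply: IHu.
by rewrite -[u]/(behead (a :: u)) -[v]/(behead (b ::
  v)) !word_code_behead eq_uv.
Qed.

Lemma word_code_surj : 0 < n -> forall c, exists w, word_code w = c.
Proof.
move=> n0; elim/ltn_ind => -[|c] IHc; first by exists [::].
have d0 : 0 < n.*2 by lia.
have [|w wE] := IHc (c %/ n.*2); first by rewrite ltnS leq_div.
have lt_m : (c %% n.*2)./2 < n by have := ltn_pmod c d0; lia.
exists ((Ordinal lt_m, odd (c %% n.*2)) :: w).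
rewrite word_code_cons wE /letter_code /= [_.*2 + _]addnC odd_double_half.
by rewrite addnS -divn_eq.
Qed.

Lemma size_le_word_code w : size w <= word_code w.
Proof.
elim: w => //= a w IHw; have := letter_code_lt a.
case: n.*2 => // d _; nia.
Qed.

Lemma word_code_eq0 w : (word_code w == 0) = (w == [::]).
Proof. by case: w => //= a w; rewrite addnS. Qed.

Lemma word_code_cat u v :
  word_code (u ++ v) = word_code u + word_code v * n.*2 ^ size u.
Proof.
elim: u => [|a u IHu]; first by rewrite muln1.
by rewrite cat_cons !word_code_cons IHu /= expnS; lia.
Qed.

Lemma word_code_take k w :
  word_code (take k w) = word_code w - word_code (drop k w) * n.*2 ^ k.
Proof.
have [lt_k|le_k] := ltnP k (size w); last by rewrite take_oversize //
  drop_oversize ?mul0n ?subn0.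
by rewrite -{2}(cat_take_drop k w) word_code_cat size_take lt_k addnK.
Qed.

Lemma word_code_bound w : word_code w < n.*2.+1 ^ size w.
Proof.
elim: w => //= a w IHw; rewrite expnS; have := letter_code_lt a.
by move: (word_code w) (_ ^ _) IHw (letter_code a) => c e; nia.
Qed.

(** The letter is read off the code by arithmetic alone; past the end of [w] the value is 0. *)
Definition letter_at w k : nat := (word_code (drop k w)).-1 %% n.*2.

Lemma letter_at_nth a0 w k :
  k < size w -> letter_at w k = letter_code (nth a0 w k).
Proof. by move=> lt_k; rewrite /letter_at (drop_nth a0) // word_code_head. Qed.

Lemma word_inv_rcons w a : word_inv (rcons w a) = (a.1, ~~ a.2) :: word_inv w.
Proof. by rewrite /word_inv map_rcons rev_rcons. Qed.

End WordCodes.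

(** * Computable operations on codes and bounded search over words *)

Section ComputableWords.
Variable n : nat.
Hypothesis n_gt0 : 0 < n.

Definition computable_word (W : (nat -> nat) -> word n) : Prop :=
  computable (fun e => word_code (W e)).

Let d_gt0 : 0 < n.*2. Proof. by rewrite double_gt0. Qed.

(** Bijective numeration makes every number the code of exactly one word, so variables can be read
    as words without a validity test. *)
Definition word_of_code (c : nat) : word n := projT1 (cid (word_code_surj n_gt0
  c)).

Lemma word_of_codeK c : word_code (word_of_code c) = c.
Proof. by rewrite /word_of_code; case: cid. Qed.

Lemma word_codeK w : word_of_code (word_code w) = w.
Proof. by apply: word_code_inj; rewrite word_of_codeK. Qed.

Lemma computable_word_of_code a :
  computable a -> computable_word (fun e => word_of_code (a e)).
Proof. by apply: computable_ext => e; rewrite word_of_codeK. Qed.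

Lemma computable_word_const w : computable_word (fun=> w).
Proof. exact: computable_const. Qed.

Lemma computable_word_shift W :
  computable_word W -> computable_word (fun e => W (shift2 e)).
Proof. exact: (computable_shift (f := fun e => word_code (W e))). Qed.

Lemma computable_drop W k : computable_word W -> computable k ->
  computable_word (fun e => drop (k e) (W e)).
Proof.
move=> Wr kr; apply: computable_ext (computable_prim_rec
  (s := fun _ _ r => r.-1 %/ n.*2) Wr kr _) => [e|].
  elim: (k e) => [|m /= ->]; first by rewrite drop0.
  by rewrite -word_code_behead -drop1 drop_drop.
by apply: computable_div => //; apply/computable_pred/computable_var.
Qed.

(** The length is the number of nonempty suffixes [drop m w]; the code of [w] bounds the range of
    [m]. *)
Lemma computable_size W : computable_word W -> computable (fun e => size (W e)).
Proof.
move=> Wr; apply: computable_ext (computable_sum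
  (F := fun e m => word_code (drop m (W e)) != 0) Wr _) => [e|]; last first.
  apply: computable_not; apply: (computable_eq (b := fun=> 0)).
    exact: (computable_drop (computable_word_shift Wr) (computable_var 0)).
  exact: computable_const.
have le_s := size_le_word_code (W e).
under eq_bigr do rewrite word_code_eq0 -size_eq0 size_drop subn_eq0 -ltnNge.
exact: sum_ltn.
Qed.

Lemma computable_cat U V : computable_word U -> computable_word V ->
  computable_word (fun e => U e ++ V e).
Proof.
move=> Ur Vr; apply: computable_ext (computable_add Ur (computable_mul Vr
  (computable_expn (computable_const n.*2) (computable_size Ur)))) => e.
by rewrite word_code_cat.
Qed.

Lemma computable_take W k : computable_word W -> computable k ->
  computable_word (fun e => take (k e) (W e)).
Proof.
move=> Wr kr; apply: computable_ext (computable_sub Wr (computable_mul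
  (computable_drop Wr kr) (computable_expn (computable_const n.*2) kr))) => e.
by rewrite word_code_take.
Qed.

Lemma computable_letter_at W k : computable_word W -> computable k ->
  computable (fun e => letter_at (W e) (k e)).
Proof.
by move=> Wr kr; apply: computable_mod => //;
  apply/computable_pred/computable_drop.
Qed.

(** Scanning [w] from the left, each inverted letter is put in front of the result. As the first
    letter is the least significant digit, this is one multiplication and one addition. *)
Lemma computable_inv W : computable_word W ->
  computable_word (fun e => word_inv (W e)).
Proof.
move=> Wr; pose l (w : word n) k := (letter_at w k).+1 - (letter_at w k %% 2) *
  2.
have c := computable_const.
apply: computable_ext (computable_prim_rec
  (s := fun e m r => r * n.*2 + (l (W e) m).+1) (c 0) (computable_size Wr) _).
  move=> e; set w := W e; rewrite -[in RHS](take_size w).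
  have := leqnn (size w); elim: {1 3 4}(size w) => [|m IHm] lt_m;
    first by rewrite take0.
  have a0 : 'I_n * bool := (Ordinal n_gt0, false).
  rewrite (take_nth a0) // word_inv_rcons word_code_cons letter_code_inv.
  by rewrite -(IHm (ltnW lt_m)) /= /l (letter_at_nth a0) // muln2.
apply: computable_add; first by apply: computable_mul => //; apply:
  computable_var.
have ar : computable (fun e => letter_at (W (shift2 e)) (e 0)).
  exact: (computable_letter_at (computable_word_shift Wr) (computable_var 0)).
apply/computable_succ/computable_sub; first exact: computable_succ.
by apply: computable_mul => //; apply: computable_mod.
Qed.

Lemma computable_pow W k : computable_word W -> computable k ->
  computable_word (fun e => word_pow (W e) (k e)).
Proof.
move=> Wr kr; apply: computable_ext (computable_prim_rec
  (s := fun e _ r => word_code (W e ++ word_of_code r)) (computable_const 0) kr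
    _).
  move=> e; elim: (k e) => [|m /= ->] //.
  by rewrite word_codeK.
apply: (computable_cat (computable_word_shift Wr)).
exact/computable_word_of_code/computable_var.
Qed.

Lemma computable_word_exists B (P : (nat -> nat) -> word n -> bool) :
  computable B -> computable (fun e => P (shift2 e) (word_of_code (e 0))) ->
  (forall e w, P e w -> exists2 v, P e v & size v <= B e) ->
  exists2 Q : (nat -> nat) -> bool,
    computable Q & forall e, Q e <-> exists w, P e w.
Proof.
move=> Br Pr short.
(* All words of length at most [B e] have codes below this power. *)
exists (fun e => [exists i : 'I_(n.*2.+1 ^ B e), P e (word_of_code i)]).
  apply: (computable_exists (P := fun e i => P e (word_of_code i))) => //.
  by apply: computable_expn => //; apply: computable_const.
move=> e; split=> [/existsP[i Pi]|[w /short[v Pv le_v]]];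
  first by exists (word_of_code i).
have lt_v : word_code v < n.*2.+1 ^ B e.
  exact: leq_trans (word_code_bound v) (leq_pexp2l _ _).
by apply/existsP; exists (Ordinal lt_v); rewrite /= word_codeK.
Qed.

Lemma decidable_word_setP (P : word n -> Prop) (b : (nat -> nat) -> bool) :
  computable b -> (forall e, P (word_of_code (e 0)) <-> b e) ->
  decidable_word_set P.
Proof.
move=> br bP; exists (fun v => b (nth 0 v)).
split; first exact: (computable_recursive _ br).
move=> w; have := bP (nth 0 [tuple word_code w]); rewrite /= word_codeK.
by move=> ->; case: (b _); split.
Qed.

Lemma decidable_word_relP (R : word n -> word n -> Prop)
    (b : (nat -> nat) -> bool) :
  computable b ->
  (forall e, R (word_of_code (e 0)) (word_of_code (e 1)) <-> b e) ->
  decidable_word_rel R.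
Proof.
move=> br bP; exists (fun v => b (nth 0 v)).
split; first exact: (computable_recursive _ br).
move=> u v; have := bP (nth 0 [tuple word_code u; word_code v]).
by rewrite /= !word_codeK => ->; case: (b _); split.
Qed.

Lemma decidable_word_set_bool (P : word n -> Prop) :
  decidable_word_set P ->
  exists2 b : word n -> bool, forall w, P w <-> b w &
    forall W, computable_word W -> computable (fun e => b (W e)).
Proof.
move=> [f [fr fP]]; exists (fun w => f [tuple word_code w] == 1) => [w|W Wr].
  by rewrite fP; split => /eqP.
exact: (computable_eq (computable_rec1 fr Wr) (computable_const 1)).
Qed.

(** With [u] empty, this extracts the word problem from the power and conjugacy problems. *)
Lemma decidable_word_rel_set (R : word n -> word n -> Prop) (u : word n) :
  decidable_word_rel R -> decidable_word_set (R u).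
Proof.
move=> [f [fr fP]].
exists (fun v => f [tuple of [:: word_code u; thead v]]); split => [|w];
  last first.
  by rewrite fP theadE.
pose g (i : 'I_2) (v : 1.-tuple nat) := if val i == 0 then word_code u else
  thead v.
have -> : (fun v : 1.-tuple nat => f [tuple of [:: word_code u; thead v]]) =
    fun v => f [tuple g i v | i < 2].
  apply/funext => v; congr f; apply: eq_from_tnth => i.
  by rewrite tnth_mktuple (tnth_nth 0); case: i => -[|[|i]].
apply: rec_comp => // -[[|[|i]] lti] //; rewrite /g /=; last exact: rec_proj.
elim: (word_code u) => [|c IHc]; first exact: rec_zero.
pose h (v : 1.-tuple nat) := (thead v).+1.
have -> : (fun _ : 1.-tuple nat => c.+1) = fun v => h [tuple c | i < 1].
  by apply/funext => v; rewrite /h /thead tnth_mktuple.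
exact: (rec_comp rec_succ (fun=> IHc)).
Qed.

End ComputableWords.

Local Open Scope group_scope.

(** * Subgroups and congruence modulo the commutator subgroup *)

Section Commutators.
Variables (G : groupType) (H : set G).
Hypothesis sgH : is_subgroup H.
Local Notation C := (commutator_set H H).

Lemma subgroup1 : H 1. Proof. by case: sgH. Qed.
Lemma subgroupM g h : H g -> H h -> H (g * h).
Proof. by case: sgH => _ + _; apply. Qed.
Lemma subgroupV g : H g -> H g^-1. Proof. by case: sgH => _ _; apply. Qed.
Lemma subgroupJ g h : H g -> H h -> H (g ^ h).
Proof. by move=> Hg Hh; apply: subgroupM (subgroupV Hh) (subgroupM Hg Hh). Qed.
Lemma subgroupMl g h : H g -> H (g * h) <-> H h.
Proof.
move=> Hg; split=> [Hgh|]; last exact: subgroupM.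
by rewrite -(mulKg g h); apply: subgroupM Hgh; apply: subgroupV.
Qed.

Lemma commutator_set_sub : (C `<=` H)%classic.
Proof.
apply: smallest_sub => // _ [a Ha [b Hb <-]].
by rewrite /commg; apply: subgroupM; [apply: subgroupV|apply: subgroupJ].
Qed.

Lemma commutator_setR a b : H a -> H b -> C [~ a, b].
Proof. by move=> Ha Hb; apply: sub_gen_smallest; exists a => //; exists b. Qed.

Lemma commutator_setJ g h : C g -> H h -> C (g ^ h).
Proof.
move=> Cg Hh; have [C1 CM CV] : is_subgroup C by exact: smallest_subgroup.
move: g Cg; apply: (_ : C `<=` [set a | C (a ^ h)])%classic.
apply: smallest_sub.
  split=> [|a b|a] /=; first by rewrite conj1g.
    by rewrite conjMg; apply: CM.
  by rewrite conjVg; apply: CV.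
by move=> _ [a Ha [b Hb <-]] /=; rewrite conjRg;
  apply: commutator_setR; apply: subgroupJ.
Qed.

End Commutators.

Lemma commutator_set_subgroup (G : groupType) (H : set G) :
  is_subgroup (commutator_set H H).
Proof. exact: smallest_subgroup. Qed.

Section EqMod.
Variables (G : groupType) (H : set G).
Hypothesis sgH : is_subgroup H.

Definition eqmod (K : set G) (a b : G) : Prop := K (a^-1 * b).

Lemma eqmod_refl a : eqmod H a a.
Proof. by rewrite /eqmod mulVg; apply: subgroup1. Qed.
Lemma eqmod_trans b a c : eqmod H a b -> eqmod H b c -> eqmod H a c.
Proof. by move=> ab bc; have := subgroupM sgH ab bc; rewrite -mulgA mulVKg. Qed.
Lemma eqmod_mull K k a b : eqmod K a b -> eqmod K (k * a) (k * b).
Proof. by rewrite /eqmod invgM -mulgA mulKg. Qed.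
End EqMod.

Section ProductsModCommutators.
Variables (G : groupType) (H : set G).
Hypothesis sgH : is_subgroup H.
Local Notation C := (commutator_set H H).
Local Notation "a ~ b" := (eqmod C a b) (at level 70).

Let sgC : is_subgroup C. Proof. exact: commutator_set_subgroup. Qed.

Lemma eqmodC_mulr k a b : H k -> a ~ b -> a * k ~ b * k.
Proof.
move=> Hk /(commutator_setJ sgH)/(_ Hk).
by rewrite /eqmod invgM /conjg !mulgA.
Qed.

Lemma eqmodC_swap a b : H a -> H b -> a * b ~ b * a.
Proof.
move=> Ha Hb; have := commutator_setR Hb Ha.
by rewrite /eqmod invgM /commg /conjg !mulgA.
Qed.

Lemma prod_subgroup (E : Type) (v : E -> G) (l : seq E) :
  (forall e, H (v e)) -> H (\prod_(e <- l) v e).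
Proof.
by move=> Hv; elim: l => [|e l IHl]; rewrite ?big_nil ?big_cons;
  [apply: subgroup1|apply: subgroupM].
Qed.

(** [H] is abelian modulo its commutator subgroup, so the order of the factors is irrelevant
    there. *)
Lemma eqmodC_perm (E : eqType) (v : E -> G) (l1 l2 : seq E) :
  (forall e, H (v e)) -> perm_eq l1 l2 ->
  \prod_(e <- l1) v e ~ \prod_(e <- l2) v e.
Proof.
move=> Hv; elim: l1 l2 => [|a l1 IHl] l2.
  by rewrite perm_sym => /perm_nilP->; apply: eqmod_refl.
move=> pl; have al2 : a \in l2 by rewrite -(perm_mem pl) mem_head.
case/splitPr: al2 pl => p1 p2 pl.
have {}pl : perm_eq l1 (p1 ++ p2).
  rewrite -(perm_cons a); apply: perm_trans pl _.
  by rewrite (perm_catCA p1 [:: a] p2).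
rewrite big_cons big_cat big_cons /=.
apply: (eqmod_trans sgC (eqmod_mull (v a) (IHl _ pl))).
rewrite big_cat !mulgA; apply: eqmodC_mulr; first exact: prod_subgroup.
by apply: eqmodC_swap; rewrite //; apply: prod_subgroup.
Qed.

End ProductsModCommutators.

(** * Signed products *)

Definition signed_value (E : Type) (G : groupType) (v : E -> G)
    (e : E * bool) : G :=
  if e.2 then (v e.1)^-1 else v e.1.

Definition signed_count (E : eqType) (l : seq (E * bool)) (e : E) : int :=
  ((count_mem (e, false) l)%:Z - (count_mem (e, true) l)%:Z)%R.

(** A pair of opposite occurrences can be moved together and cancelled modulo commutators, without
    changing any signed count; induction on the length removes all such pairs. *)
Lemma signed_reduce (G : groupType) (H : set G) (E : eqType) (v : E -> G)
    (l : seq (E * bool)) :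
  is_subgroup H -> (forall e, H (v e)) ->
  exists l', [/\ eqmod (commutator_set H H) (\prod_(e <- l) signed_value v e)
                   (\prod_(e <- l') signed_value v e),
    forall e, signed_count l' e = signed_count l e &
    forall e, (e, false) \in l' -> (e, true) \notin l'].
Proof.
move=> sgH Hv; have sgC := commutator_set_subgroup H.
have Hsv e : H (signed_value v e).
  by rewrite /signed_value; case: e.2 => //; apply: subgroupV.
elim: {l}(size l) {-2}l (leqnn (size l)) => [|k IHk] l le_l.
  by exists [::]; move: le_l; rewrite leqn0 size_eq0 => /eqP->; split=> //;
    apply: eqmod_refl.
have [[e [ef et]]|none] :=
    pselect (exists e, (e, false) \in l /\ (e, true) \in l); last first.
  exists l; split=> // [|e ef]; first exact: eqmod_refl.
  by apply/negP => et; apply: none; exists e.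
have p1 := perm_to_rem ef; set l1 := rem _ _ in p1.
have et1 : (e, true) \in l1.
  by move: et; rewrite (perm_mem p1) inE => /orP[/eqP[]|].
have p2 := perm_to_rem et1; set l2 := rem _ _ in p2.
have p : perm_eq l [:: (e, false), (e, true) & l2].
  by apply: perm_trans p1 _; rewrite perm_cons.
have [|l' [pr ct red]] := IHk l2; first by move: le_l; rewrite (perm_size p) /=;
  lia.
exists l'; split=> // [|d].
  apply: (eqmod_trans sgC (eqmodC_perm sgH Hsv p)).
  by rewrite !big_cons /signed_value /= mulVKg.
rewrite ct /signed_count !(permP p) /= !xpair_eqE.
by case: (e == d); rewrite /= ?add0n //; lia.
Qed.

(** * Flows of words in Schreier graphs *)

Lemma word_value_cat n (G : groupType) (x : 'I_n -> G) u v :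
  word_value x (u ++ v) = word_value x u * word_value x v.
Proof. by elim: u => [|a u IHu] /=; rewrite ?mul1g // IHu mulgA. Qed.

Lemma word_value_inv n (G : groupType) (x : 'I_n -> G) u :
  word_value x (word_inv u) = (word_value x u)^-1.
Proof.
elim: u => [|a u IHu]; first by rewrite /= invg1.
rewrite /word_inv /= rev_cons -cats1 word_value_cat -/(word_inv u) IHu /= mulg1
  invgM.
by congr (_ * _); rewrite /letter_value /=; case: a.2; rewrite /= ?invgK.
Qed.

Lemma word_value_pow n (G : groupType) (x : 'I_n -> G) u k :
  word_value x (word_pow u k) = word_value x u ^+ k.
Proof. by elim: k => [|k IHk] //; rewrite expgS -IHk -word_value_cat. Qed.

(* The semidirect product of the functions on F with F, which acts by
   translation: its sections over F are the cocycles defined below. *)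
Definition twisted (F : groupType) := ((F -> int) * F)%type.

Section Twisted.
Variable F : groupType.
Implicit Types a b c : twisted F.

HB.instance Definition _ := Choice.on (twisted F).

Definition twisted_mul a b : twisted F :=
  ((fun s => a.1 s + b.1 (s * a.2)%g)%R, a.2 * b.2).
Definition twisted_one : twisted F := (fun=> 0%R, 1).
Definition twisted_inv a : twisted F :=
  ((fun s => - a.1 (s * a.2^-1)%g)%R, a.2^-1).

Lemma twisted_mulA : associative twisted_mul.
Proof.
move=> a b c; congr (_, _) => /=; last by rewrite mulgA.
by apply/funext => s /=; rewrite addrA mulgA.
Qed.

Lemma twisted_mul1 : left_id twisted_one twisted_mul.
Proof.
move=> [a1 a2]; congr (_, _) => /=; last by rewrite mul1g.
by apply/funext => s /=; rewrite add0r mulg1.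
Qed.

Lemma twisted_mulr1 : right_id twisted_one twisted_mul.
Proof.
move=> [a1 a2]; congr (_, _) => /=; last by rewrite mulg1.
by apply/funext => s /=; rewrite addr0.
Qed.

Lemma twisted_mulV : left_inverse twisted_one twisted_inv twisted_mul.
Proof.
move=> [a1 a2]; congr (_, _) => /=; last by rewrite mulVg.
by apply/funext => s /=; rewrite addNr.
Qed.

Lemma twisted_mulrV : right_inverse twisted_one twisted_inv twisted_mul.
Proof.
move=> [a1 a2]; congr (_, _) => /=; last by rewrite mulgV.
by apply/funext => s /=; rewrite mulgK addrN.
Qed.

HB.instance Definition _ := isGroup.Build (twisted F)
  twisted_mulA twisted_mul1 twisted_mulr1 twisted_mulV twisted_mulrV.

Definition cocycle (phi : F -> F -> int) : Prop :=
  forall g h s, phi (g * h) s = (phi g s + phi h (s * g)%g)%R.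

Lemma cocycle1 phi s : cocycle phi -> phi 1 s = 0%R.
Proof. by move=> /(_ 1 1 s); rewrite !mulg1; lia. Qed.

Lemma cocycleV phi g s : cocycle phi -> phi g^-1 s = (- phi g (s * g^-1)%g)%R.
Proof.
move=> phiM; have := phiM g^-1 g s; rewrite mulVg (cocycle1 s phiM).
by move: (phi _ _) (phi _ _) => a b; lia.
Qed.

Lemma multiplicative_of (G K : groupType) (f : G -> K) :
  {morph f : a b / a * b} -> exists f' : {multiplicative G -> K}, f' =1 f.
Proof.
move=> fM; pose m := isMultiplicative.Build G K f fM.
by exists (HB.pack_for {multiplicative G -> K} f m).
Qed.

End Twisted.

Section Flows.
Variables (n : nat) (F : groupType) (x : 'I_n -> F).
Hypothesis hx : free_basis x.
Implicit Types (w : word n) (g h s t : F) (i j : 'I_n) (H : set F).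
Local Notation vx := (word_value x).

(** A cocycle [phi] is the same as a morphism [g |-> (phi g, g)] into the twisted group, which
    freeness determines by its values on the basis. *)
Lemma cocycle_unique phi psi :
  cocycle phi -> cocycle psi -> (forall j, phi (x j) =1 psi (x j)) ->
  forall g, phi g =1 psi g.
Proof.
have hom (f : F -> F -> int) : cocycle f ->
    exists f' : {multiplicative F -> twisted F}, forall g, f' g = (f g, g).
  move=> fM; apply: (multiplicative_of (f := fun g => (f g, g) : twisted F)) =>
    a b.
  by congr (_, _); apply/funext => s; rewrite fM.
move=> /hom[f fE] /hom[f' f'E] eq_gen g s.
have [_ uniq_f] := hx (fun j => (phi (x j), x j) : twisted F).
have : f g = f' g.
  apply: uniq_f => j; rewrite ?fE // f'E; congr (_, _).
  by apply/funext => t; rewrite eq_gen.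
by rewrite fE f'E => -[->].
Qed.

Lemma cocycle_exists (c : 'I_n -> F -> int) :
  exists2 phi, cocycle phi & forall j s, phi (x j) s = c j s.
Proof.
have [[f fE] _] := hx (fun j => (c j, x j) : twisted F).
have fM g h : f (g * h) = f g * f h by rewrite gmulfM.
(* The second component is an endomorphism of [F] fixing the basis, hence the identity. *)
have f2 g : (f g).2 = g.
  have [|p pE] := multiplicative_of (f := fun g => (f g).2).
    by move=> a b; rewrite fM.
  have [|q qE] := multiplicative_of (f := fun g : F => g); first by [].
  have [_ uniq_f] := hx x.
  rewrite -[RHS]qE -pE; apply: uniq_f => j; rewrite ?pE ?qE //.
  by rewrite fE.
exists (fun g => (f g).1) => [g h s|j s]; last by rewrite fE.
by rewrite fM /= f2.
Qed.

(** Freeness is only a universal property, so generation needs an argument. The coboundary of the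
    indicator of the set [S] of values of words vanishes on the basis, hence everywhere, and [S]
    contains 1. *)
Lemma word_value_surj g : exists w, vx w = g.
Proof.
pose S : set F := [set g | exists w, vx w = g]%classic.
have Sx s j : S (s * x j) <-> S s.
  split=> -[w wE]; last by exists (w ++ [:: (j, false)]);
    rewrite word_value_cat wE /= mulg1.
  by exists (w ++ [:: (j, true)]); rewrite word_value_cat wE /= mulg1 mulgK.
pose ind s : int := (`[< S s >] : nat).
pose phi g s : int := (ind (s * g)%g - ind s)%R.
have phiM : cocycle phi by move=> a b s; rewrite /phi !mulgA [RHS]addrC addrA
  subrK.
have zeroM : @cocycle F (fun _ _ => 0%R) by [].
have gen j : phi (x j) =1 (fun=> 0%R).
  by move=> s; rewrite /phi /ind (asbool_equiv_eq (Sx s j)) subrr.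
have := cocycle_unique phiM zeroM gen g 1.
have /asboolP S1 : S 1 by exists [::].
by rewrite /phi /ind mul1g S1; case: asboolP.
Qed.

(** Fox expansion of a cocycle along the path labelled [w] from [s]. An inverse letter is charged,
    negatively, at the end of its step, where the positive edge begins. *)
Fixpoint weight (c : 'I_n -> F -> int) w s : int :=
  if w is a :: w' then
    ((if a.2 then - c a.1 (s * (x a.1)^-1)%g else c a.1 s)
     + weight c w' (s * letter_value x a)%g)%R
  else 0%R.

Lemma cocycle_word phi w s :
  cocycle phi -> phi (vx w) s = weight (fun j => phi (x j)) w s.
Proof.
move=> phiM; elim: w s => [|a w IHw] s /=; first exact: cocycle1.
rewrite phiM IHw; congr (_ + _)%R; rewrite /letter_value.
by case: a.2 => //; apply: cocycleV.
Qed.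

(* The edges of the Schreier graph of H are pairs of a coset Hh and a generator
   x_i; [flow H h i g s] counts the passages through the edge (Hh, x_i) along
   the path labelled g that starts at Hs. *)
Definition edge_weight H h i j s : int :=
  (`[< H (s * h^-1) >] && (j == i) : nat).

Definition flow H h i : F -> F -> int :=
  projT1 (cid2 (cocycle_exists (edge_weight H h i))).

Lemma flowM H h i : cocycle (flow H h i).
Proof. by rewrite /flow; case: cid2. Qed.

Lemma flow_word H h i w s :
  flow H h i (vx w) s = weight (edge_weight H h i) w s.
Proof.
rewrite (cocycle_word _ _ (flowM H h i)); congr weight.
by apply/funext => j; apply/funext => t; rewrite /flow; case: cid2.
Qed.

Lemma flow_subgroup H h i g k s :
  is_subgroup H -> H k -> flow H h i g (k * s) = flow H h i g s.
Proof.
move=> sgH Hk; have [w <-] := word_value_surj g; rewrite !flow_word.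
have wt j t : edge_weight H h i j (k * t) = edge_weight H h i j t.
  by rewrite /edge_weight -mulgA (asbool_equiv_eq (subgroupMl sgH _ Hk)).
by elim: w s => //= a w IHw s; rewrite -!mulgA IHw !wt.
Qed.

(** For normal [M] the graph is a Cayley graph, on which left translations act by automorphisms. *)
Lemma flow_translate (M : normal_subgroup F) h i g s t :
  flow M h i g (s * t) = flow M (s^-1 * h) i g t.
Proof.
have [w <-] := word_value_surj g; rewrite !flow_word.
have wt j k : edge_weight M h i j (s * k) = edge_weight M (s^-1 * h) i j k.
  congr (Posz (nat_of_bool (_ && _))); apply: asbool_equiv_eq;
    rewrite invgM invgK.
  split=> Mk; first by have := nsub_conj s Mk;
    rewrite /conjg !mulgA mulVg mul1g.
  by have := nsub_conj s^-1 Mk; rewrite /conjg invgK !mulgA mulgK.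
by elim: w t => //= a w IHw t; rewrite -!mulgA IHw !wt.
Qed.

Lemma flow_bound H h i w s : (`|flow H h i (vx w) s| <= size w)%N.
Proof.
rewrite flow_word; elim: w s => //= a w IHw s.
move: (IHw (s * letter_value x a)); move: (weight _ _ _) => k.
by rewrite /edge_weight; case: a.2; case: andb; lia.
Qed.

Lemma flow_support H h i w s : flow H h i (vx w) s != 0%R ->
  exists2 k, (k <= size w)%N & H (s * vx (take k w) * h^-1).
Proof.
rewrite flow_word; elim: w s => //= a w IHw s.
have [->|/IHw[k le_k Hk] _] :=
    eqVneq (weight (edge_weight H h i) w (s * letter_value x a)) 0%R.
  rewrite addr0 /edge_weight; case: a => j [] /=; case: asboolP => //= Hs _.
    by exists 1%N; rewrite //= take0 /= mulg1.
  by exists 0%N; rewrite //= mulg1.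
by exists k.+1; rewrite //= mulgA.
Qed.

(** Elements of [H] label closed paths at the base vertex, so there the flow is a homomorphism from
    [H] to the integers and kills commutators. *)
Lemma flow_commutator H h i g :
  is_subgroup H -> commutator_set H H g -> flow H h i g 1 = 0%R.
Proof.
move=> sgH; have phiM := flowM H h i.
have hom a b : H a ->
    flow H h i (a * b) 1 = (flow H h i a 1 + flow H h i b 1)%R.
  by move=> Ha; rewrite phiM mul1g -{2}(mulg1 a) flow_subgroup.
have homV a : H a -> flow H h i a^-1 1 = (- flow H h i a 1)%R.
  by move=> Ha; have := hom a a^-1 Ha; rewrite mulgV cocycle1 //; lia.
pose K := [set a | H a /\ flow H h i a 1 = 0%R]%classic.
suff KC : (commutator_set H H `<=` K)%classic by move=> /KC[].
apply: smallest_sub => [|_ [a Ha [b Hb <-]]].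
  split=> [|a b [Ha a0] [Hb b0]|a [Ha a0]]; split;
    rewrite ?hom ?homV ?a0 ?b0 //.
  - exact: subgroup1.
  - exact: cocycle1.
  - exact: subgroupM.
  - exact: subgroupV.
split; first by rewrite /commg; apply: subgroupM (subgroupV sgH Ha) (subgroupJ
  sgH Ha Hb).
rewrite /commg /conjg !hom ?homV //; [lia|exact: subgroupV..].
Qed.

(** Conjugating by [s^-1] moves the base point from [s] to 1 and keeps [g] in the derived subgroup
    of [M], which lies in that of [H]. *)
Lemma flow_derived (M : normal_subgroup F) H h i g s :
  is_subgroup H -> (M `<=` H)%classic -> nsub_set (derived M) g ->
    flow H h i g s = 0%R.
Proof.
move=> sgH MH dg; have phiM := flowM H h i.
have Cg : commutator_set H H (g ^ s^-1).
  have : nsub_set (derived M) (g ^ s^-1) by apply: nsub_conj.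
  apply: sub_smallest2r; first exact: commutator_set_subgroup.
  by move=> _ [a /MH Ha [b /MH Hb <-]]; exists a => //; exists b.
have Hg := commutator_set_sub sgH Cg.
have := flow_commutator h i sgH Cg; move: Hg; rewrite /conjg invgK => Hg.
rewrite !phiM mul1g (cocycleV _ _ phiM) -mulgA -[s * (g * s^-1)]mulg1.
by rewrite flow_subgroup // addrC subrK.
Qed.

End Flows.

(** * The projection to a quotient as a group morphism *)

Lemma quotient_projE1 (G : groupType) (M : normal_subgroup G) :
  quotient_proj M 1 = 1.
Proof. by []. Qed.

HB.instance Definition _ (G : groupType) (M : normal_subgroup G) :=
  Multiplicative_isUMagmaMorphism.Build G (quotient M) (quotient_proj M)
    (quotient_projE1 M).

Section QuotientMorphism.
Variables (G : groupType) (M : normal_subgroup G).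
Local Notation p := (quotient_proj M).

Lemma projM g h : p (g * h) = p g * p h. Proof. exact: gmulfM. Qed.
Lemma projV g : p g^-1 = (p g)^-1. Proof. exact: gmulfV. Qed.
Lemma projX g k : p (g ^+ k) = p g ^+ k. Proof. exact: gmulfXn. Qed.
Lemma projR g h : p [~ g, h] = [~ p g, p h]. Proof. exact: gmulfR. Qed.
Lemma projJ g h : p (g ^ h) = p g ^ p h. Proof. exact: gmulfJ. Qed.

Lemma proj_eq1 g : p g = 1 <-> nsub_set M g.
Proof.
rewrite -(quotient_projE1 M).
split=> [/esym/quotient_projP|Mg]; first by rewrite invg1 mul1g.
by apply/esym/quotient_projP; rewrite invg1 mul1g.
Qed.

End QuotientMorphism.

(** * Schreier generators and the normal form given by a flow *)

Section Flows.
Variables (n : nat) (F : groupType) (x : 'I_n -> F).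
Hypothesis hx : free_basis x.
Implicit Types (w : word n) (g h s t : F) (i j : 'I_n) (H : set F).
Local Notation vx := (word_value x).
Local Notation flow := (flow hx).

(** A word of least length in the coset [Hs]; minimality serves the length bounds for conjugators.
    The defining set depends only on the coset, so the choice does too. *)
Definition coset_word H s : word n :=
  xget [::] [set w | H (vx w * s^-1) /\
                     forall v, H (vx v * s^-1) -> (size w <= size v)%N]%classic.

Definition coset_rep H s : F := vx (coset_word H s).

Lemma coset_wordP H s : is_subgroup H ->
  H (coset_rep H s * s^-1) /\
  forall v, H (vx v * s^-1) -> (size (coset_word H s) <= size v)%N.
Proof.
move=> sgH; rewrite /coset_rep /coset_word; case: xgetP => // noW.
have exk : exists k, `[< exists w, size w = k /\ H (vx w * s^-1) >].
  have [w wE] := word_value_surj hx s.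
  by exists (size w); apply/asboolP; exists w; rewrite wE mulgV; split=> //;
    apply: subgroup1.
case: (ex_minnP exk) => k /asboolP[w [<- Hw]] min_w; exfalso.
apply: (noW w); split=> // v Hv.
by apply: min_w; apply/asboolP; exists v.
Qed.

Lemma coset_word_eq H s t :
  is_subgroup H -> H (s * t^-1) -> coset_word H s = coset_word H t.
Proof.
move=> sgH Hst; rewrite /coset_word; congr xget.
have eqH g : H (g * s^-1) <-> H (g * t^-1).
  split=> Hg; first by have := subgroupM sgH Hg Hst; rewrite mulgA mulgVK.
  by have := subgroupM sgH Hg (subgroupV sgH Hst);
    rewrite invgM invgK mulgA mulgVK.
apply/seteqP; split=> w /= [/eqH Hw min_w]; split=> // v /eqH; exact: min_w.
Qed.

Lemma coset_rep_eq H s t :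
  is_subgroup H -> (coset_rep H s == coset_rep H t) = `[< H (s * t^-1) >].
Proof.
move=> sgH; apply/eqP/asboolP => [eq_st|Hst];
  last by rewrite /coset_rep (coset_word_eq sgH Hst).
have [Hs _] := coset_wordP s sgH; have [Ht _] := coset_wordP t sgH.
have := subgroupM sgH (subgroupV sgH Hs) Ht; rewrite eq_st invgM invgK.
by rewrite -mulgA mulKg.
Qed.

Lemma coset_repK H t :
  is_subgroup H -> coset_rep H (coset_rep H t) = coset_rep H t.
Proof.
move=> sgH; apply/eqP; rewrite coset_rep_eq //; apply/asboolP.
by case: (coset_wordP t sgH).
Qed.

(** The Schreier generator of [H] attached to an edge. *)
Definition edge_loop H (e : F * 'I_n) : F :=
  coset_rep H e.1 * x e.2 * (coset_rep H (e.1 * x e.2))^-1.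

Fixpoint trace H w s : seq ((F * 'I_n) * bool) :=
  if w is a :: w' then
    (if a.2 then ((coset_rep H (s * (x a.1)^-1), a.1), true)
     else ((coset_rep H s, a.1), false)) :: trace H w' (s * letter_value x a)
  else [::].

Lemma edge_loop_in H e : is_subgroup H -> H (edge_loop H e).
Proof.
move=> sgH; case: e => h i; rewrite /edge_loop /=.
have [Hh _] := coset_wordP h sgH; have [Hhx _] := coset_wordP (h * x i) sgH.
by have := subgroupM sgH Hh (subgroupV sgH Hhx);
  rewrite !invgM !invgK !mulgA mulgVK.
Qed.

(** Schreier rewriting: the representatives at consecutive vertices telescope. *)
Lemma trace_prod H w s : is_subgroup H ->
  \prod_(e <- trace H w s) signed_value (edge_loop H) e =
  coset_rep H s * vx w * (coset_rep H (s * vx w))^-1.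
Proof.
move=> sgH; elim: w s => [|a w IHw] s.
  by rewrite big_nil /= !mulg1 mulgV.
have repM t j : coset_rep H (coset_rep H t * x j) = coset_rep H (t * x j).
  apply/eqP; rewrite coset_rep_eq //; apply/asboolP.
  by rewrite invgM mulgA mulgK; case: (coset_wordP t sgH).
have repK t := coset_repK t sgH.
rewrite /= big_cons IHw.
set e := if _ then _ else _.
have -> : signed_value (edge_loop H) e = coset_rep H s * letter_value x a *
    (coset_rep H (s * letter_value x a))^-1.
  rewrite /e /signed_value /edge_loop /letter_value.
  case: a.2 => /=; rewrite repK repM // !invgM invgK mulgVK mulgA.
  by rewrite -mulgA.
by rewrite !mulgA mulgVK.
Qed.

Lemma trace_count H h i w s : is_subgroup H ->
  signed_count (trace H w s) (coset_rep H h, i) = flow H h i (vx w) s.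
Proof.
move=> sgH; rewrite flow_word; elim: w s => //= a w IHw s.
rewrite -IHw /signed_count /= /edge_weight -!coset_rep_eq //.
case: a.2; rewrite /= !xpair_eqE eqb_id /= ?andbF ?andbT /=;
  case: andb; lia.
Qed.

Lemma trace_edge H w s (e : F * 'I_n) : is_subgroup H ->
  signed_count (trace H w s) e != 0%R -> coset_rep H e.1 = e.1.
Proof.
move=> sgH; elim: w s => [|a w IHw] s //=; rewrite /signed_count /=.
have repK t := coset_repK t sgH.
case: a => j b; set d := if _ then _ else _.
have [<- _|/negPf ne_de] := eqVneq d.1 e; first by rewrite /d; case: (b) => /=.
have ne b' : (d == (e, b')) = false.
  by apply/eqP => dE; move: ne_de; rewrite dE eqxx.
by rewrite !ne; apply: IHw.
Qed.

(** The trace of a word for [g] is reduced modulo commutators. Each remaining edge then occurs with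
    a single sign, so its multiplicity is the absolute value of the flow. *)
Lemma flow_normal_form H g s : is_subgroup H ->
  exists l : seq ((F * 'I_n) * bool),
    eqmod (commutator_set H H) (coset_rep H s * g * (coset_rep H (s * g))^-1)
      (\prod_(e <- l) signed_value (edge_loop H) e) /\
    forall e, e \in l -> [/\ coset_rep H e.1.1 = e.1.1,
      flow H e.1.1 e.1.2 g s != 0%R &
      count_mem e l = `|flow H e.1.1 e.1.2 g s|%N].
Proof.
move=> sgH; have [w <-] := word_value_surj hx g.
have [l [pl ct red]] := signed_reduce (trace H w s) sgH (fun e =>
  edge_loop_in e sgH).
exists l; split; first by rewrite -trace_prod.
move=> [[h i] b] el /=.
have cE : `|signed_count l (h, i)|%N = count_mem ((h, i), b) l.
  rewrite /signed_count; case: b el => [et|/red/count_memPn->];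
    last by rewrite subr0.
  suff /count_memPn-> : ((h, i), false) \notin l by rewrite sub0r abszN.
  by apply/negP => /red; rewrite et.
have c0 : count_mem ((h, i), b) l != 0 by rewrite -lt0n -has_count has_pred1.
have sc0 : signed_count (trace H w s) (h, i) != 0%R by rewrite -ct -absz_eq0 cE.
have hE : coset_rep H h = h := trace_edge sgH sc0.
have fE : flow H h i (vx w) s = signed_count l (h, i).
  by rewrite ct -[in RHS]hE trace_count.
by split; rewrite ?fE ?cE // ct.
Qed.

Lemma coset_rep_1 H : is_subgroup H -> coset_rep H 1 = 1.
Proof.
move=> sgH; have [_ min_w] := coset_wordP 1 sgH.
have := min_w [::]; rewrite /= invg1 mulg1 leqn0 size_eq0 /coset_rep.
by move=> /(_ (subgroup1 sgH))/eqP->.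
Qed.

(** Converse of [flow_commutator]: with zero flow the normal form is the empty product. *)
Lemma commutator_of_flow H g : is_subgroup H -> H g ->
  (forall h i, flow H h i g 1 = 0%R) -> commutator_set H H g.
Proof.
move=> sgH Hg flow0; have [l [pl lP]] := flow_normal_form g 1 sgH.
have l0 : l = [::].
  case: l lP {pl} => // e l /(_ e); rewrite mem_head => /(_ isT)[_ /eqP[]].
  exact: flow0.
have repg : coset_rep H g = 1.
  rewrite -(coset_rep_1 sgH); apply/eqP; rewrite coset_rep_eq //.
  by apply/asboolP; rewrite invg1 mulg1.
move: pl; rewrite l0 big_nil mul1g repg coset_rep_1 // mul1g invg1 mulg1.
by rewrite /eqmod mulg1 => /(subgroupV (commutator_set_subgroup H));
  rewrite invgK.
Qed.

Lemma flow_nonzero H g : is_subgroup H -> H g -> ~ commutator_set H H g ->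
  exists h i, flow H h i g 1 != 0%R.
Proof.
move=> sgH Hg nCg; apply: contrapT => flow0; apply: nCg.
apply: commutator_of_flow => // h i; apply/eqP; apply: contrapT => /negP hi.
by apply: flow0; exists h, i.
Qed.

(** * Powers and centralizers modulo derived subgroups *)

Lemma proj_derived_commute (M : normal_subgroup F) g h :
  nsub_set M g -> nsub_set M h ->
  quotient_proj (derived M) (g * h) = quotient_proj (derived M) (h * g).
Proof.
move=> Mg Mh; apply/quotient_projP; exact: eqmodC_swap.
Qed.

(* The subgroup <u>M, with u^j m written through natural exponents. *)
Definition cyclic_extension (M : normal_subgroup F) u : set F :=
  [set g | exists a b,
     quotient_proj M (u ^+ a) * quotient_proj M g =
     quotient_proj M (u ^+ b)]%classic.

Section CyclicExtension.
Variables (M : normal_subgroup F) (u : F).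
Local Notation H := (cyclic_extension M u).
Local Notation p := (quotient_proj M).

Lemma cyclic_extension_sub : (M `<=` H)%classic.
Proof. by move=> g /proj_eq1 Mg; exists 0, 0; rewrite Mg mulg1. Qed.

Lemma cyclic_extension_gen : H u.
Proof. by exists 0, 1%N; rewrite expg0 quotient_projE1 mul1g. Qed.

Lemma cyclic_extension_commute g h : H g -> H h -> commute (p g) (p h).
Proof.
have cX k a b (c : quotient M) : p (u ^+ a) * c = p (u ^+ b) ->
  commute (p (u ^+ k)) c.
  move=> eq_c; have -> : c = (p (u ^+ a))^-1 * p (u ^+ b) by rewrite -eq_c
    mulKg.
  rewrite !projX; apply: commuteM; first apply: commuteV.
    by apply: commuteX2.
  by apply: commuteX2.
move=> [a [b gE]] [c [d hE]]; have -> : p g = (p (u ^+ a))^-1 * p (u ^+ b).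
  by rewrite -gE mulKg.
apply: commute_sym; apply: commuteM; first apply: commuteV;
  apply: commute_sym; exact: cX hE.
Qed.

Lemma cyclic_extension_subgroup : is_subgroup H.
Proof.
have uH k : H (u ^+ k) by exists 0, k; rewrite expg0 quotient_projE1 mul1g.
split=> [|g h Hg Hh|g Hg]; first exact: (uH 0).
  have [a [b gE]] := Hg; have [c [d hE]] := Hh; exists (c + a)%N, (b + d)%N.
  have := cyclic_extension_commute (uH c) Hg => cg.
  have := cyclic_extension_commute (uH c) (uH b) => cb.
  rewrite !expgnDr !projM -!mulgA -hE [p (u ^+ a) * _]mulgA gE.
  by rewrite !mulgA cb.
have [a [b gE]] := Hg; exists b, a.
by rewrite -gE projV mulgK.
Qed.

Lemma cyclic_extension_derived : (commutator_set H H `<=` M)%classic.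
Proof.
apply: smallest_sub => [|_ [g Hg [h Hh <-]]]; first exact: nsub_subgroup.
apply/proj_eq1; rewrite projR.
by apply/eqP/commgP; apply: cyclic_extension_commute.
Qed.

(** [H/M] is abelian, so [u] in [[H, H]] would lie in [M]. Then [H = M], and [u] would be in the
    derived subgroup of [M]. *)
Lemma cyclic_extension_not_derived :
  ~ nsub_set (derived M) u -> ~ commutator_set H H u.
Proof.
move=> nMu CHu; have Mu := cyclic_extension_derived CHu; apply: nMu.
suff HM : (H `<=` M)%classic.
  have := CHu; apply: sub_smallest2r; first exact: commutator_set_subgroup.
  by move=> _ [g /HM Mg [h /HM Mh <-]]; exists g => //; exists h.
move=> g [a [b]]; move/proj_eq1: Mu; rewrite !projX => ->.
by rewrite !expg1n mul1g => /proj_eq1.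
Qed.

End CyclicExtension.

Lemma flow_power H h i g k :
  is_subgroup H -> H g -> flow H h i (g ^+ k) 1 = (flow H h i g 1 *+ k)%R.
Proof.
move=> sgH Hg; have phiM := flowM hx H h i.
elim: k => [|k IHk]; first by rewrite cocycle1.
by rewrite expgS phiM mul1g -{3}(mulg1 g) flow_subgroup // IHk mulrS.
Qed.

(* The flow of u^k in the Schreier graph of <u>M is k times that of u, which
   does not vanish, while the flow of v is bounded by the length of v. *)
Lemma power_length (M : normal_subgroup F) u w k :
  ~ nsub_set (derived M) u ->
  quotient_proj (derived M) (u ^+ k) = quotient_proj (derived M) (vx w) ->
  (k <= size w)%N.
Proof.
move=> nMu /quotient_projP Mv; have sgH := cyclic_extension_subgroup M u.
have Hu := cyclic_extension_gen M u.
have [h [i hi]] := flow_nonzero sgH Hu (cyclic_extension_not_derived nMu).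
have := flow_bound hx (cyclic_extension M u) h i w 1.
have -> : vx w = u ^+ k * ((u ^+ k)^-1 * vx w) by rewrite mulVKg.
rewrite flowM flow_power // (flow_derived hx _ _ _ sgH _ Mv); last exact:
  cyclic_extension_sub.
rewrite addr0 -mulr_natr abszM natz absz_nat; apply: leq_trans.
by rewrite leq_pmull // absz_gt0.
Qed.

(** A path has finite length, while [power_length] forces the vertices [u^k h] to move arbitrarily
    far away. *)
Lemma flow_not_periodic (K : normal_subgroup F) h i g u :
  ~ nsub_set (derived K) u ->
  exists k, flow (derived K) (u ^+ k * h) i g 1 = 0%R.
Proof.
move=> nMu; apply: contrapT => nz.
have [w wE] := word_value_surj hx g; have [v vE] := word_value_surj hx h^-1.
pose k := (size w + size v).+1.
have : flow (derived K) (u ^+ k * h) i (vx w) 1 != 0%R.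
  by apply/eqP => fk; apply: nz; exists k; rewrite -wE.
move=> /flow_support[j le_j Mj].
suff : (k <= size (take j w ++ v))%N by rewrite size_cat size_take /k;
  case: ifP; lia.
apply: (power_length nMu); apply/esym/quotient_projP.
have := nsub_conj (u ^+ k) (subgroupV (nsub_subgroup (derived K)) Mj).
by rewrite word_value_cat vE /conjg mul1g !invgM !invgK -!mulgA mulKg.
Qed.

Lemma derived_centralizer (K : normal_subgroup F) g u :
  nsub_set (derived K) g -> ~ nsub_set (derived (derived K)) g ->
  nsub_set (derived (derived K)) [~ u, g] -> nsub_set (derived K) u.
Proof.
set M := derived K => Mg nM'g M'ug; apply: contrapT => nMu.
have sgM := nsub_subgroup M.
have [h [i hi]] := flow_nonzero sgM Mg nM'g.
(* The flows of [u * g] and [g * u] agree; cancelling the contribution of [u] leaves the flow of [g]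
   and its translate. *)
have per h' : flow M (u^-1 * h') i g 1 = flow M h' i g 1.
  have phiM := flowM hx M h' i.
  have := phiM u g 1; rewrite commgC phiM.
  rewrite (flow_derived hx _ _ _ sgM _ M'ug) // phiM !mul1g.
  have := flow_subgroup hx h' i u 1 sgM Mg; rewrite mulg1 => ->.
  have := flow_translate hx M h' i g u 1; rewrite mulg1 => ->.
  by rewrite addr0 addrC => /addrI.
have nMu' : ~ nsub_set M u^-1 by move=> /(subgroupV sgM); rewrite invgK.
have [k] := flow_not_periodic h i g nMu'.
elim: k => [|k IHk]; first by rewrite mul1g => /eqP; rewrite (negPf hi).
by rewrite expgS -mulgA per.
Qed.

End Flows.

(** * Short conjugators *)

(** Up to [k1] the sequence changes only during the last [L] steps before [k1] and at [k1] itself,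
    by at most [t] each time. Starting from 0, it cannot exceed [L * t] at [J], and a nonzero value
    there requires a recent change. *)
Lemma bounded_window (a : nat -> int) (J k1 L t : nat) :
  a 0 = 0%R -> a J != 0%R -> (J <= k1)%N -> a k1.+1 != a k1 ->
  (forall k, `|(a k.+1 - a k)%R| <= t)%N ->
  (forall k, k <= k1 -> a k.+1 != a k -> k1 - k <= L)%N ->
  (`|a J| <= L * t)%N /\
  exists k, [/\ (k < J)%N, (J - k.+1 <= L)%N & a k.+1 != a k].
Proof.
move=> a0 aJ le_J ne_k1 bnd win; split.
  have bound m : (m <= J)%N -> (`|a m| <= (m - (k1 - L)) * t)%N.
    elim: m => [|m IHm] lt_m; first by rewrite a0.
    have {}IHm := IHm (ltnW lt_m); have [eq_m|ne_m] := eqVneq (a m.+1) (a m).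
      by rewrite eq_m; apply: leq_trans IHm _;
        rewrite leq_mul2r leq_sub2r ?orbT.
    have := win m (leq_trans (ltnW lt_m) le_J) ne_m => le_L.
    rewrite subSn; last by lia.
    by rewrite mulSn; have := bnd m; move: (_ * t)%N IHm => c; lia.
  apply: leq_trans (bound J (leqnn J)) _; rewrite leq_mul2r; apply/orP; right;
    lia.
have [k lt_k ne_k] : exists2 k, (k < J)%N & a k.+1 != a k.
  apply: contrapT => no_k; move: aJ; rewrite (_ : a J = 0%R) ?eqxx //.
  have : (J <= J)%N by []; elim: {1 3}J => // m IHm lt_m.
  rewrite -(IHm (ltnW lt_m)); apply/eqP; apply: contrapT => /negP ne_m.
  by apply: no_k; exists m.
by exists k; split=> //; have := win k _ ne_k; lia.
Qed.

Lemma size_multiplicity (T : eqType) (l s : seq T) (k : nat) :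
  {subset l <= s} -> (forall e, e \in l -> count_mem e l <= k)%N ->
  (size l <= size s * k)%N.
Proof.
elim: s l => [|a s IHs] l sub_l cnt.
  by case: l sub_l {cnt} => // b l /(_ b (mem_head _ _)).
have := count_predC (pred1 a) l; rewrite -!size_filter => <-.
rewrite mulSn leq_add //.
  rewrite size_filter; have [/cnt//|/count_memPn->//] := boolP (a \in l).
apply: IHs => [e|e]; rewrite mem_filter => /andP[/= ne_e el].
  by have := sub_l _ el; rewrite inE (negPf ne_e).
by apply: leq_trans (cnt e el); rewrite count_filter; apply: sub_count =>
  b /andP[].
Qed.

(* The number of signed edges, times the number of passages through an edge,
   times the length of the loop of an edge, plus the length of the coset
   representative. *)
Definition conjugator_bound (n t : nat) : nat :=
  (((4 * t).+1 * t.+2 * n * 2) * (4 * t * t) * ((4 * t * t + 2 * t).*2.+2) +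
    t)%N.

Section ShortConjugators.
Variables (n : nat) (F : groupType) (x : 'I_n -> F).
Hypothesis hx : free_basis x.
Implicit Types (w : word n) (g h s t : F) (i j : 'I_n) (H : set F).
Local Notation vx := (word_value x).
Local Notation flow := (flow hx).
Local Notation rep := (coset_rep x).
Local Notation repw := (coset_word x).

Definition edge_word H (e : (F * 'I_n) * bool) : word n :=
  let w := repw H e.1.1 ++
    (e.1.2, false) :: word_inv (repw H (e.1.1 * x e.1.2)) in
  if e.2 then word_inv w else w.

Lemma size_word_inv w : size (word_inv w) = size w.
Proof. by rewrite size_rev size_map. Qed.

Lemma edge_wordE H e : vx (edge_word H e) = signed_value (edge_loop x H) e.
Proof.
have E : vx (repw H e.1.1 ++ (e.1.2, false) ::
  word_inv (repw H (e.1.1 * x e.1.2)))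
    = edge_loop x H e.1.
  by rewrite word_value_cat /= word_value_inv /edge_loop mulgA.
by rewrite /edge_word /signed_value; case: e.2; rewrite ?word_value_inv E.
Qed.

(** The representative at the far end has length at most [d + 1], so the loop has length at most
    [d + 1 + (d + 1)]. *)
Lemma size_edge_word H e d : is_subgroup H -> (size (repw H e.1.1) <= d)%N ->
  (size (edge_word H e) <= d.*2.+2)%N.
Proof.
move=> sgH le_d.
suff le_w : (size (repw H (e.1.1 * x e.1.2)) <= d.+1)%N.
  by rewrite /edge_word; case: e.2; rewrite ?size_word_inv size_cat /=
    size_word_inv; lia.
have [Hr _] := coset_wordP hx e.1.1 sgH.
have [_ min_w] := coset_wordP hx (e.1.1 * x e.1.2) sgH.
apply: leq_trans (min_w (rcons (repw H e.1.1) (e.1.2, false)) _) _.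
  by rewrite -cats1 word_value_cat /= mulg1 invgM mulgA mulgK.
by rewrite size_rcons.
Qed.

Lemma size_flatten_le (T : eqType) (S : seq (seq T)) d :
  (forall u, u \in S -> size u <= d)%N -> (size (flatten S) <= size S * d)%N.
Proof.
elim: S => //= u S IHS le_d; rewrite size_cat mulSn leq_add //.
  by apply: le_d; rewrite mem_head.
by apply: IHS => v Sv; apply: le_d; rewrite inE Sv orbT.
Qed.

(** * Bounding conjugators modulo the second derived subgroup of [K] *)

Section Conjugacy.
Variables (K : normal_subgroup F) (u v : word n).
Local Notation M := (derived K).
Local Notation p := (quotient_proj (derived M)).
Local Notation t := (size u + size v)%N.
Let sgM : is_subgroup M. Proof. exact: nsub_subgroup. Qed.

(** Conjugation of [u] by [g] depends only on the coset of [g] modulo the abelian group [M/M']. An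
    edge carrying the flow of both paths expresses that coset by a prefix of [u] and a prefix of
    [v]. *)
Lemma conjugator_short_in g :
  nsub_set M (vx u) -> p (vx v) = p (vx u) ^ p g ->
  exists2 w, p (vx v) = p (vx u) ^ p (vx w) & (size w <= t)%N.
Proof.
move=> Mu uv.
have [M'u|nM'u] := pselect (nsub_set (derived M) (vx u)).
  exists [::] => //; move: uv; have /proj_eq1-> := M'u.
  by rewrite !conj1g.
have [h [i hi]] := flow_nonzero hx sgM Mu nM'u.
have uvE : vx u * g * ((vx u ^ g)^-1 * vx v) = g * vx v.
  by rewrite mulgA (conjgC (vx u) g) mulgK.
have M'v : nsub_set (derived M) ((vx u ^ g)^-1 * vx v).
  by apply/quotient_projP; rewrite projJ.
have phiM := flowM hx M h i.
have fE : flow M h i (vx v) g = flow M h i (vx u) 1.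
  have := phiM g (vx v) 1; rewrite -uvE phiM
    (flow_derived hx _ _ _ sgM _ M'v) //.
  rewrite phiM !mul1g; have := flow_subgroup hx h i g 1 sgM Mu;
    rewrite mulg1 => ->.
  by rewrite addr0 addrC => /addrI.
have [k le_k Mk] := flow_support hi.
rewrite -fE in hi; have [l le_l Ml] := flow_support hi.
exists (take k u ++ word_inv (take l v)); last first.
  rewrite size_cat size_word_inv leq_add // size_take_min; exact: geq_minr.
rewrite mul1g in Mk; have := subgroupM sgM Ml (subgroupV sgM Mk).
rewrite word_value_cat word_value_inv invgM invgK mulgA mulgVK => Mm.
set m := g * _ * _ in Mm; set q := vx (take k u) / _.
have gE : g = m * q by rewrite /m /q !mulgA !mulgVK mulgK.
rewrite uv gE projM conjgM; congr (_ ^ _).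
by rewrite conjgE -(projM _ (vx u) m) (proj_derived_commute Mu Mm) projM mulKg.
Qed.

(* The flow Q of g satisfies Q(h) - Q(u^-1 h) = D(h), where D depends only on
   u, v and the coset of g; the growth of the powers of u modulo K' then bounds
   the support and the values of Q. Normalizing g edge by edge, with shortest
   coset representatives, gives a short word with the same image. *)
Lemma conjugator_short_coset g c :
  ~ nsub_set M (vx u) -> p (vx v) = p (vx u) ^ p g ->
  nsub_set M (g * (vx c)^-1) -> (size c <= t)%N ->
  exists2 w, p (vx v) = p (vx u) ^ p (vx w) &
    (size w <= conjugator_bound n t)%N.
Proof.
move=> nMu uv Mgc le_c.
have M'v : nsub_set (derived M) ((vx u ^ g)^-1 * vx v).
  by apply/quotient_projP; rewrite projJ.
have uvE : vx u * g * ((vx u ^ g)^-1 * vx v) = g * vx v.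
  by rewrite mulgA (conjgC (vx u) g) mulgK.
pose Q h i := flow M h i g 1.
pose D h i := (flow M h i (vx u) 1 - flow M h i (vx v) g)%R.
have QD h i : D h i = (Q h i - Q ((vx u)^-1 * h)%g i)%R.
  have phiM := flowM hx M h i.
  have := phiM g (vx v) 1; rewrite -uvE phiM
    (flow_derived hx _ _ _ sgM _ M'v) //.
  rewrite phiM !mul1g; have := flow_translate hx M h i g (vx u) 1;
    rewrite mulg1 => ->.
  rewrite addr0 /D /Q; move: (flow M h i g 1) (flow M h i (vx v) g).
  by move: (flow M h i (vx u) 1) (flow M _ i g 1) => a b a' b'; lia.
have QDu h i k : D (vx u ^+ k.+1 * h)%g i =
    (Q (vx u ^+ k.+1 * h)%g i - Q (vx u ^+ k * h)%g i)%R.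
  by rewrite QD; congr (_ - Q _ _)%R; rewrite expgS -!mulgA mulKg.
(* [D] is a difference of two flows, of paths of lengths [size u] and [size v]. *)
have D_bound h i : (`|D h i| <= t)%N.
  have := flow_bound hx M h i u 1; have := flow_bound hx M h i v g.
  by rewrite /D; move: (flow _ _ _ _ _) (flow _ _ _ _ _) => a b; lia.
pose S := [seq take k u | k <- iota 0 (size u).+1] ++
          [seq c ++ take k v | k <- iota 0 (size v).+1].
have S_size (s : word n) : s \in S -> (size s <= 2 * t)%N.
  rewrite mem_cat => /orP[] /mapP[k _ ->]; rewrite ?size_cat size_take_min.
    by have := geq_minr k (size u); lia.
  by have := geq_minr k (size v); lia.
have D_supp h i : D h i != 0%R -> exists2 s : word n,
  s \in S & nsub_set M (vx s * h^-1).
  have [f0|/flow_support[k le_k Mk] _] := eqVneq (flow M h i (vx u) 1) 0%R;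
    last first.
    exists (take k u); last by rewrite mul1g in Mk.
    by rewrite mem_cat; apply/orP; left; apply/mapP; exists k;
      rewrite // mem_iota.
  rewrite /D f0 sub0r oppr_eq0 => /flow_support[k le_k Mk].
  exists (c ++ take k v); last first.
    have := subgroupM sgM (subgroupV sgM Mgc) Mk.
    by rewrite word_value_cat invgM invgK !mulgA mulgVK.
  by rewrite mem_cat; apply/orP; right; apply/mapP; exists k;
    rewrite // mem_iota.
(* Two words of [S], each of length at most [2 * t], express [u^k] modulo [M]; [power_length] then
   bounds [k]. *)
have D_window h i k : D h i != 0%R -> D (vx u ^+ k * h) i != 0%R ->
  (k <= 4 * t)%N.
  move=> /D_supp[s sS Ms] /D_supp[s' s'S Ms'].
  suff : (k <= size (s' ++ word_inv s))%N.
    by rewrite size_cat size_word_inv; have := S_size _ sS;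
      have := S_size _ s'S; lia.
  apply: (power_length hx nMu); apply/esym/quotient_projP.
  have := subgroupM sgM Ms (nsub_conj (vx u ^+ k) (subgroupV sgM Ms')).
  by rewrite word_value_cat word_value_inv /conjg !invgM !invgK -!mulgA !mulKg.
have Q_window h i : Q h i != 0%R -> (`|Q h i| <= 4 * t * t)%N /\
    exists (j : nat) (s : word n), [/\ (j <= 4 * t)%N, s \in S &
                    nsub_set M (h * (vx u ^+ j * vx s)^-1)].
  move=> Qh; have nMu' : ~ nsub_set M (vx u)^-1 by move=> /(subgroupV sgM);
    rewrite invgK.
  have [J QJ] := flow_not_periodic hx h i g nMu'.
  (* The orbit of [h] under [u] is followed from a point [h0] behind it where [Q] vanishes. [Q] also
     vanishes ahead of [h], so it changes at some [k1] past [J]; every change is a point of the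
     support of [D]. *)
  pose h0 := (vx u)^-1 ^+ J * h; pose a k := Q (vx u ^+ k * h0) i.
  have aE k : a (k + J)%N = Q (vx u ^+ k * h) i.
    by rewrite /a /h0 expgnDr expVgn -!mulgA mulVKg.
  have aJ : a J = Q h i by rewrite -[J]add0n aE mul1g.
  have [k1 le_J ne_k1] : exists2 k1, (J <= k1)%N & a k1.+1 != a k1.
    apply: contrapT => const_a; have [k Qk] := flow_not_periodic hx h i g nMu.
    move: Qh; rewrite -aJ (_ : a J = 0%R) ?eqxx // -Qk -/(Q _ _) -aE.
    elim: k {Qk} => // k ->; apply/esym/eqP; apply: contrapT => /negP ne_k.
    by apply: const_a; exists (k + J)%N; rewrite ?leq_addl.
  have aD k : (a k.+1 - a k)%R = D (vx u ^+ k.+1 * h0) i by rewrite QDu.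
  have [||||||bnd [k [lt_k le_k ne_k]]] := @bounded_window a J k1 (4 * t) t.
  - by rewrite /a mul1g.
  - by rewrite aJ.
  - exact: le_J.
  - exact: ne_k1.
  - by move=> k; rewrite aD.
  - move=> k le_k ne_k; apply: (D_window (vx u ^+ k.+1 * h0) i).
      by rewrite -aD subr_eq0.
    rewrite mulgA -expgnDr addnS subnK // -aD subr_eq0.
    exact: ne_k1.
  rewrite -aJ; split=> //.
  have [|s sS Ms] := D_supp (vx u ^+ k.+1 * h0) i;
    first by rewrite -aD subr_eq0.
  exists (J - k.+1)%N, s; split=> //.
  have -> : h = vx u ^+ (J - k.+1) * (vx u ^+ k.+1 * h0).
    by rewrite mulgA -expgnDr subnK // /h0 expVgn mulVKg.
  have := nsub_conj (vx u ^+ (J - k.+1))^-1 (subgroupV sgM Ms).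
  by rewrite /conjg !invgM !invgK !mulgA.
have [l [pl lP]] := flow_normal_form hx g 1 sgM.
(* All signed edges that can occur in the normal form: [4 * t + 1] powers of [u], [t + 2] words of
   [S], [n] generators and two signs. *)
pose T := [seq (e, b) | e <- [seq (h, i) | h <- [seq rep M (vx u ^+ k * vx w) |
  k <- iota 0 (4 * t).+1, w <- S], i <- enum 'I_n], b <- [:: false; true]].
have size_T : size T = ((4 * t).+1 * t.+2 * n * 2)%N.
  rewrite !size_allpairs size_iota size_enum_ord size_cat !size_map !size_iota.
  by rewrite addSn addnS.
have size_l : (size l <= size T * (4 * t * t))%N.
  apply: size_multiplicity => e el; have [repE Qe ct] := lP e el; last first.
    by have [le_Q _] := Q_window _ _ Qe; move: le_Q; rewrite /Q -ct.
  have [_ [j [s [le_j sS Ms]]]] := Q_window _ _ Qe.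
  case: e {el ct} repE Qe Ms => -[h i] b /= repE Qe Ms.
  apply: allpairs_f; last by case: b.
  apply: allpairs_f; last by rewrite mem_enum.
  rewrite -repE; have /eqP-> : rep M h == rep M (vx u ^+ j * vx s).
    by rewrite coset_rep_eq //; apply/asboolP.
  by apply: (allpairs_f (fun k w => rep M (vx u ^+ k * vx w)));
    rewrite ?mem_iota.
exists (flatten [seq edge_word M e | e <- l] ++ repw M g).
  rewrite uv; congr (_ ^ _); rewrite word_value_cat projM.
  have <- : p (g * (rep M g)^-1) =
      p (vx (flatten [seq edge_word M e | e <- l])).
    apply/quotient_projP; move: pl; rewrite coset_rep_1 // !mul1g /eqmod.
    congr (commutator_set _ _ (_ * _)).
    elim: (l) => [|e l' IHl]; first by rewrite big_nil.
    by rewrite big_cons /= word_value_cat edge_wordE IHl.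
  by rewrite -projM mulgVK.
rewrite size_cat leq_add //; last first.
  have [_ min_w] := coset_wordP hx g sgM; apply: leq_trans (min_w c _) le_c.
  by have := subgroupV sgM Mgc; rewrite invgM invgK.
rewrite -size_T.
apply: leq_trans (_ : size l * (4 * t * t + 2 * t).*2.+2 <= _)%N; last first.
  by rewrite leq_mul2r size_l orbT.
rewrite -(size_map (edge_word M)); apply: size_flatten_le => _ /mapP[e el ->].
apply: size_edge_word => //; have [repE Qe _] := lP e el.
have [_ [j [s [le_j sS Ms]]]] := Q_window _ _ Qe.
have [_ min_w] := coset_wordP hx e.1.1 sgM.
apply: leq_trans (min_w (word_pow u j ++ s) _) _.
  have := subgroupV sgM Ms.
  by rewrite word_value_cat word_value_pow invgM invgK.
rewrite size_cat leq_add ?S_size // /word_pow size_flatten /shape map_nseq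
  sumn_nseq.
by rewrite mulnC leq_mul // leq_addr.
Qed.

(** When [u] is outside [M], comparing flows in the graph of [<u>M] locates [g] only up to powers of
    [u]. Multiplying [g] by such a power on the left does not change the conjugate of [u], so [g]
    can be given a short coset modulo [M]. *)
Lemma conjugator_short g : p (vx v) = p (vx u) ^ p g ->
  exists2 w, p (vx v) = p (vx u) ^ p (vx w) &
    (size w <= conjugator_bound n t)%N.
Proof.
move=> uv; have [Mu|nMu] := pselect (nsub_set M (vx u)).
  have [w wP le_w] := conjugator_short_in Mu uv.
  by exists w => //; apply: leq_trans le_w _;
    rewrite /conjugator_bound leq_addl.
have M'v : nsub_set (derived M) ((vx u ^ g)^-1 * vx v).
  by apply/quotient_projP; rewrite projJ.
have uvE : vx u * g * ((vx u ^ g)^-1 * vx v) = g * vx v.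
  by rewrite mulgA (conjgC (vx u) g) mulgK.
set H := cyclic_extension M (vx u).
have sgH : is_subgroup H := cyclic_extension_subgroup M _.
have Hu : H (vx u) := cyclic_extension_gen M _.
have nM'u : ~ nsub_set (derived M) (vx u) by move=> /(commutator_set_sub sgM).
have [h [i hi]] := flow_nonzero hx sgH Hu (cyclic_extension_not_derived nM'u).
have phiM := flowM hx H h i.
have fE : flow H h i (vx v) g = flow H h i (vx u) 1.
  have := phiM g (vx v) 1; rewrite -uvE phiM (flow_derived hx _ _ _ sgH _ M'v);
    last first.
    exact: cyclic_extension_sub.
  rewrite phiM !mul1g; have := flow_subgroup hx h i g 1 sgH Hu;
    rewrite mulg1 => ->.
  by rewrite addr0 addrC => /addrI.
have [k le_k Hk] := flow_support hi.
rewrite -fE in hi; have [m le_m Hm] := flow_support hi.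
rewrite mul1g in Hk; have := subgroupM sgH Hm (subgroupV sgH Hk).
rewrite invgM invgK mulgA mulgVK => -[a [b]].
rewrite -projM => /quotient_projP Mab.
pose c := take k u ++ word_inv (take m v).
pose g' := (vx u ^+ b)^-1 * (vx u ^+ a) * g.
apply: (@conjugator_short_coset g' c) => //.
- rewrite uv /g' !projM conjgM; congr (_ ^ _).
  rewrite conjgE projV !projX; apply/esym.
  have cu : commute (p (vx u)) ((p (vx u) ^+ b)^-1 * p (vx u) ^+ a).
    by apply: commuteM; [apply/commuteV|]; apply: commuteX.
  by rewrite cu mulKg.
- have := subgroupV sgM Mab; rewrite /g' /c word_value_cat word_value_inv !invgM
    !invgK.
  by rewrite !mulgA.
rewrite size_cat size_word_inv leq_add // size_take_min; exact: geq_minr.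
Qed.

End Conjugacy.
End ShortConjugators.

(** * Reductions between the algorithmic problems *)

Lemma decidable_word_set_iff n (P Q : word n -> Prop) :
  (forall w, P w <-> Q w) -> decidable_word_set P -> decidable_word_set Q.
Proof. by move=> PQ [f [fr fP]]; exists f; split=> // w; rewrite -PQ. Qed.

Section Reductions.
Variables (n : nat) (F : groupType) (x : 'I_n -> F).
Hypotheses (n_gt0 : (0 < n)%N) (hx : free_basis x).
Implicit Types (w u v : word n) (M K : normal_subgroup F).
Local Notation vx := (word_value x).
Local Notation flow := (flow hx).
Local Notation pd M := (quotient_proj (derived M)).

Lemma word_value_quotient M w :
  word_value (quotient_gen x M) w = quotient_proj M (vx w).
Proof.
elim: w => //= a w ->; rewrite projM /letter_value /quotient_gen.
by case: a.2; rewrite ?projV.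
Qed.

Lemma WP_nsub M w : WP (quotient_gen x M) w <-> nsub_set M (vx w).
Proof. by rewrite /WP word_value_quotient; exact: proj_eq1. Qed.

Lemma decidable_nsub M : WP_decidable x M ->
  exists2 b : word n -> bool, forall w, nsub_set M (vx w) <-> b w &
    forall W, computable_word W -> computable (fun e => b (W e)).
Proof.
by move=> /decidable_word_set_bool[b bP br]; exists b => // w;
  rewrite -bP WP_nsub.
Qed.

Lemma PP_WP M : PP_decidable x M -> WP_decidable x M.
Proof.
move=> /(decidable_word_rel_set [::]); apply: decidable_word_set_iff => w.
rewrite /PP /WP /=; split=> [[k ->]|->]; last by exists (Posz 0).
by case: k => k /=; rewrite expg1n // invg1.
Qed.

Lemma CP_WP M : CP_decidable x M -> WP_decidable x M.
Proof.
move=> /(decidable_word_rel_set [::]); apply: decidable_word_set_iff => w.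
by rewrite /CP /WP /=; split=> [[k ->]|->]; [|exists 1]; rewrite conj1g.
Qed.

Lemma WP_PP_derived M : WP_decidable x (derived M) ->
  PP_decidable x (derived M).
Proof.
move=> /decidable_nsub[b bP br].
(* The two tests cover the exponents [k] and [-k]. *)
pose P u v k := b (word_pow u k ++ word_inv v) || b (word_pow u k ++ v).
have PPE u v : PP (quotient_gen x (derived M)) u v <->
    [exists k : 'I_(size v).+1, P u v k].
  rewrite /PP !word_value_quotient.
  have bE w : b w <-> pd M (vx w) = 1 by rewrite -bP; split=> /proj_eq1.
  split=> [[k vE]|/existsP[k /orP[/bE|/bE]]]; last 2 first.
  - rewrite word_value_cat word_value_pow word_value_inv projM projX projV.
    by move=> /divg1_eq vE; exists (Posz k).
  - rewrite word_value_cat word_value_pow projM projX => /mulg1_eq vE.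
    by case: (val k) vE => [|m] vE; [exists (Posz 0)|exists (Negz m)];
      rewrite -vE ?expg0 ?invg1.
  have [M'u|nM'u] := pselect (nsub_set (derived M) (vx u)).
    apply/existsP; exists ord0; apply/orP; right; apply/bE; rewrite vE.
    have /proj_eq1-> := M'u.
    by case: (k) => m; rewrite /= expg1n ?invg1.
  have short w m : pd M (vx u) ^+ m = pd M (vx w) -> (size w <= size v)%N ->
    (m < (size v).+1)%N.
    move=> uw; apply: leq_trans; apply: (power_length hx nM'u).
    by rewrite projX.
  case: k vE => m /= vE.
    have lt_m := short v m (esym vE) (leqnn _).
    apply/existsP; exists (Ordinal lt_m); apply/orP; left; apply/bE.
    by rewrite word_value_cat word_value_pow word_value_inv projM projX projV vE
      mulgV.
  (* [Negz m] stands for the exponent [-(m + 1)]; inverting [v] makes it positive and keeps the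
     length. *)
  have vE' : pd M (vx u) ^+ m.+1 = pd M (vx (word_inv v)).
    by rewrite word_value_inv projV vE invgK.
  have le_v : (size (word_inv v) <= size v)%N by rewrite size_word_inv.
  have lt_m := short _ _ vE' le_v.
  apply/existsP; exists (Ordinal lt_m); apply/orP; right; apply/bE.
  by rewrite word_value_cat word_value_pow projM projX vE mulgV.
have ur i : computable_word (fun e => word_of_code n_gt0 (e i)).
  exact/computable_word_of_code/computable_var.
pose u e : word n := word_of_code n_gt0 (e 0%N).
pose v e : word n := word_of_code n_gt0 (e 1%N).
apply: (decidable_word_relP (n_gt0 := n_gt0)
  (b := fun e => [exists k : 'I_(size (v e)).+1, P (u e) (v e) k])) => [|e];
    last exact: PPE.
apply: (computable_exists (P := fun e => P (u e) (v e))).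
  by apply/computable_succ/computable_size => //; exact: (ur 1%N).
(* Under the bounded quantifier, variable 0 is [k], while [u] and [v] have moved to variables 2 and
   3. *)
have powr := computable_pow n_gt0 (ur 2%N) (computable_var 0).
apply: computable_or; apply: br; apply: (computable_cat n_gt0 powr); last exact:
  (ur 3%N).
by apply: computable_inv => //; exact: (ur 3%N).
Qed.

Lemma WP_CP_derived K : WP_decidable x (derived (derived K)) ->
  CP_decidable x (derived (derived K)).
Proof.
move=> /decidable_nsub[b bP br].
pose P u v w := b (word_inv w ++ u ++ w ++ word_inv v).
have PE u v w : P u v w <->
    pd (derived K) (vx v) = pd (derived K) (vx u) ^ pd (derived K) (vx w).
  rewrite /P -bP -proj_eq1 !word_value_cat !word_value_inv !projM !projV.
  rewrite conjgE !mulgA; split=> [/divg1_eq//|->].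
  by rewrite mulgV.
have ur i : computable_word (fun e => word_of_code n_gt0 (e i)).
  exact/computable_word_of_code/computable_var.
pose u e : word n := word_of_code n_gt0 (e 0%N).
pose v e : word n := word_of_code n_gt0 (e 1%N).
have [|||Q Qr QP] := @computable_word_exists n n_gt0
  (fun e => conjugator_bound n (size (u e) + size (v e)))
  (fun e => P (u e) (v e)).
- have c := computable_const.
  have tr : computable (fun e => size (u e) + size (v e))%N.
    exact: (computable_add (computable_size n_gt0 (ur 0%N))
      (computable_size n_gt0 (ur 1%N))).
  have tr4 : computable (fun e => 4 * (size (u e) + size (v e)))%N.
    exact: computable_mul.
  have tr42 := computable_mul tr4 tr.
  apply: computable_add => //.
  apply: computable_mul; first apply: computable_mul => //.
    apply: computable_mul => //; apply: computable_mul => //.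
    by apply: computable_mul; [|apply/computable_succ]; apply/computable_succ.
  apply/computable_succ/computable_succ; under eq_fun do rewrite -muln2.
  by apply: computable_mul => //; apply: computable_add => //; apply:
    computable_mul.
- have cat := computable_cat n_gt0; have inv := computable_inv n_gt0.
  exact: (br _ (cat _ _ (inv _ (ur 0%N))
    (cat _ _ (ur 2%N) (cat _ _ (ur 0%N) (inv _ (ur 3%N)))))).
- move=> e w /PE/(conjugator_short hx)[w' uv le_w'].
  by exists w' => //; apply/PE.
apply: (decidable_word_relP (n_gt0 := n_gt0) (b := Q)) => // e.
rewrite QP /CP !word_value_quotient; split=> [[g vE]|[w /PE vE]]; last first.
  by exists (pd (derived K) (vx w)).
have [w wE] := word_value_surj hx (repr g).
by exists w; apply/PE; rewrite vE wE quotient_reprK.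
Qed.

Lemma WP_derived_WP K : WP_decidable x (derived (derived K)) ->
  WP_decidable x (derived K).
Proof.
set M := derived K => decM'.
(* This choice and the element [g] are independent of the input word, so they may be made
   classically: in either case a fixed algorithm results. *)
have [[g [Mg nM'g]]|MM'] :=
    pselect (exists g, nsub_set M g /\ ~ nsub_set (derived M) g); last first.
  apply: decidable_word_set_iff decM' => w; rewrite !WP_nsub; split.
    exact: (commutator_set_sub (nsub_subgroup M)).
  by move=> Mw; apply: contrapT => nM'w; apply: MM'; exists (vx w).
have [b bP br] := decidable_nsub decM'; have [v vE] := word_value_surj hx g.
pose u e : word n := word_of_code n_gt0 (e 0%N).
have ur : computable_word u by exact/computable_word_of_code/computable_var.
pose r w := word_inv w ++ word_inv v ++ w ++ v.
apply: (decidable_word_setP (n_gt0 := n_gt0) (b := fun e => b (r (u e)))) =>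
  [|e].
  have vr w : computable_word (fun=> w) := computable_word_const w.
  apply: br; apply: computable_cat => //; first exact: computable_inv.
  by apply: computable_cat => //; apply: computable_cat.
rewrite WP_nsub -bP -/(u e); have -> : vx (r (u e)) = [~ vx (u e), g].
  by rewrite /r !word_value_cat !word_value_inv vE.
split=> [Mu|]; first exact: commutator_setR.
exact: (derived_centralizer hx).
Qed.

(** * Deciding whether the flow of a word vanishes *)

(* Taking d = 1 when c codes an inverse letter, so that in both cases the
   prefix ends at the vertex from which the positively oriented edge leaves. *)
Definition count_visits (b : word n -> bool) w v c d : nat :=
  \sum_(k < size w)
    ((letter_at w k == c) && b (take (k + d)%N w ++ word_inv v) : nat).

(** A final letter adds at most one passage. Since the offset is at most 1, the prefixes examined
    for earlier letters are unaffected. *)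
Lemma flow_count_visits M (b : word n -> bool) w v i :
  (forall u, nsub_set M (vx u) <-> b u) ->
  flow M (vx v) i (vx w) 1 =
    ((count_visits b w v i.*2 0)%:Z - (count_visits b w v i.*2.+1 1)%:Z)%R.
Proof.
move=> bP; elim/last_ind: w => [|w a IHw].
  by rewrite /count_visits !big_ord0 (cocycle1 _ (flowM hx M _ i)).
have step c d : (d <= 1)%N -> count_visits b (rcons w a) v c d =
    (count_visits b w v c d +
     ((letter_code a == c) &&
      b (take (size w + d) (rcons w a) ++ word_inv v)))%N.
  move=> le_d; rewrite /count_visits size_rcons big_ord_recr /=;
    congr (_ + _)%N.
    apply: eq_bigr => k _; have lt_k := ltn_ord k.
    rewrite (letter_at_nth a) ?size_rcons; last exact: ltnW.
    rewrite (letter_at_nth a) // nth_rcons lt_k.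
    by rewrite -cats1 takel_cat //; lia.
  by rewrite (letter_at_nth a) ?size_rcons // nth_rcons ltnn eqxx.
rewrite !step // -{1}cats1 word_value_cat (flowM hx M _ i) IHw mul1g.
rewrite addn0 -{1}cats1 take_size_cat // addn1 take_oversize ?size_rcons //.
have bE u : b (u ++ word_inv v) = `[< nsub_set M (vx u * (vx v)^-1) >].
  by apply/idP/asboolP; rewrite -word_value_inv -word_value_cat bP.
rewrite !bE flow_word /= addr0 /edge_weight -cats1 word_value_cat /= mulg1
  /letter_value.
case: a {step} => j [] /=.
  have -> : (letter_code (j, true) == i.*2) = false by rewrite /letter_code /=;
    lia.
  have -> : (letter_code (j, true) == i.*2.+1) = (j == i).
    by rewrite /letter_code -val_eqE /=; lia.
  by rewrite andbC; lia.
have -> : (letter_code (j, false) == i.*2.+1) = false by rewrite /letter_code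
  /=; lia.
have -> : (letter_code (j, false) == i.*2) = (j == i).
  by rewrite /letter_code -val_eqE /=; lia.
by rewrite andbC; lia.
Qed.

Lemma WP_WP_derived M : WP_decidable x M -> WP_decidable x (derived M).
Proof.
move=> /decidable_nsub[b bP br]; have sgM := nsub_subgroup M.
pose E w k i := count_visits b w (take k w) i.*2 0 == count_visits b w (take k
  w) i.*2.+1 1.
pose Z w := b w && [forall k : 'I_(size w).+1, [forall i : 'I_n, E w k i]].
have ZP w : nsub_set (derived M) (vx w) <-> Z w.
  rewrite /Z; split=> [M'w|/andP[/bP Mw /forallP Zw]].
    apply/andP; split; first by apply/bP; apply: (commutator_set_sub sgM).
    apply/forallP => k; apply/forallP => i.
    have := flow_derived hx (vx (take k w)) i 1 sgM (fun g Mg => Mg) M'w.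
    by rewrite (flow_count_visits _ _ _ bP) /E => /eqP; rewrite subr_eq0.
  apply: (commutator_of_flow (hx := hx) sgM Mw) => h i; apply/eqP; apply:
    contrapT => /negP hi.
  (* An edge with nonzero flow starts at a vertex visited by [w], so testing the edges at the
     prefixes of [w] suffices. *)
  have [k le_k Mk] := flow_support hi; have lt_k : (k < (size w).+1)%N by [].
  have /forallP/(_ i)/eqP eq_c := Zw (Ordinal lt_k).
  have : flow M (vx (take k w)) i (vx w) 1 = 0%R.
    by rewrite (flow_count_visits _ _ _ bP) eq_c subrr.
  suff -> : flow M (vx (take k w)) i (vx w) 1 = flow M h i (vx w) 1 by
    apply/eqP.
  rewrite !flow_word; congr weight; apply/funext => j; apply/funext => s.
  congr (Posz (nat_of_bool (_ && _))); apply: asbool_equiv_eq;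
    rewrite mul1g in Mk.
  split=> Ms; first by have := subgroupM sgM Ms Mk; rewrite mulgA mulgVK.
  by have := subgroupM sgM Ms (subgroupV sgM Mk);
    rewrite invgM invgK mulgA mulgVK.
pose u e : word n := word_of_code n_gt0 (e 0%N).
have ur i : computable_word (fun e => word_of_code n_gt0 (e i)).
  exact/computable_word_of_code/computable_var.
apply: (decidable_word_setP (n_gt0 := n_gt0) (b := fun e => Z (u e))) => [|e];
  last first.
  by rewrite WP_nsub ZP.
apply: computable_and; first by apply: br; exact: (ur 0%N).
apply: (computable_forall (P := fun e k => [forall i : 'I_n, E (u e) k i])).
  by apply/computable_succ/computable_size => //; exact: (ur 0%N).
apply: (computable_forall (P := fun e i => E (u (shift2 e)) (e 0%N) i)).
  exact: computable_const.
(* Each binder shifts by two: the input word is variable 4 under both quantifiers and variable 6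
   inside the sum. *)
have cnt (c : (nat -> nat) -> nat) d : computable c -> computable (fun e =>
    count_visits b (u (shift2 (shift2 e))) (take (e 2%N) (u (shift2 (shift2
      e)))) (c e) d).
  move=> cr; apply: (computable_sum (F := fun e k =>
    (letter_at (u (shift2 (shift2 e))) k == c e) &&
    b (take (k + d)%N (u (shift2 (shift2 e))) ++
       word_inv (take (e 2%N) (u (shift2 (shift2 e))))) : nat)).
    by apply: computable_size => //; exact: (ur 4%N).
  apply: computable_and.
    apply: computable_eq; last exact: computable_shift.
    by apply: computable_letter_at => //; [exact: (ur 6%N)|exact:
      computable_var].
  apply: br; apply: computable_cat => //; last first.
    apply: computable_inv => //; apply: computable_take => //; first exact:
      (ur 6%N).
    exact: (computable_var 4).
  apply: computable_take => //; first exact: (ur 6%N).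
  by apply: computable_add; [exact: computable_var|exact: computable_const].
have dr : computable (fun e => (e 0%N).*2).
  under eq_fun do rewrite -muln2.
  by apply: computable_mul; [exact: computable_var|exact: computable_const].
by apply: computable_eq; apply: cnt => //; apply: computable_succ.
Qed.

End Reductions.

(* Assembling the reductions into the equivalences *)
Local Close Scope group_scope.

Theorem corollary6p16 (n : nat) (hn : 2 <= n) (F : groupType) (x : 'I_n -> F)
    (hx : free_basis x) (N : normal_subgroup F)
    (hN : enumerable_subset x N) :
  let N1 := derived N in
  let N2 := derived N1 in
  let N3 := derived N2 in
  (PP_decidable x N1 <-> PP_decidable x N2) /\
  (CP_decidable x N2 <-> CP_decidable x N3) /\
  ((WP_decidable x N2 <-> PP_decidable x N2) /\
   (PP_decidable x N2 <-> CP_decidable x N2)).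
Proof.
have n_gt0 : 0 < n by apply: leq_trans hn.
have up M := @WP_WP_derived n F x n_gt0 hx M.
have down K := @WP_derived_WP n F x n_gt0 hx K.
have pp M := @WP_PP_derived n F x n_gt0 hx M.
have cp K := @WP_CP_derived n F x n_gt0 hx K.
have ppw M := @PP_WP n F x M.
have cpw M := @CP_WP n F x M.
move=> N1 N2 N3; split; [split|split; [split|split; split]].
(* Each implication passes through word problems: down to [WP], one derived step up or down where
   the subgroups differ, then back by bounded search. *)
- by move=> /ppw/up/pp.
- by move=> /ppw/down/pp.
- by move=> /cpw/up/cp.
- by move=> /cpw/down/cp.
- exact: pp.
- exact: ppw.
- by move=> /ppw/cp.
- by move=> /cpw/pp.
Qed.
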